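(* Let $f:\mathbb{R}^n\to[0,\infty)$ be a strongly log-concave probability density function, and let $g(x)=(2\pi)^{-n/2}e^{-|x|^2/2}$ be the standard Gaussian density on $\mathbb{R}^n$. Then $g\prec_{dx} f$, i.e. $f$ majorizes $g$ with respect to Lebesgue measure.
   Context: Strongly log-concave: a probability density $f:\mathbb{R}^n\to[0,\infty)$ is strongly log-concave if there is a convex function $V:\mathbb{R}^n\to\mathbb{R}\cup\{+\infty\}$ such that $f(x)\,dx=e^{-V(x)}\gamma_n(dx)$, where $\gamma_n(dx)=(2\pi)^{-n/2}e^{-|x|^2/2}\,dx$ is the standard Gaussian measure. Majorization: $g\prec_{dx}f$ means that $\int_{\mathbb{R}^n}(\varphi(f(x))-\varphi(g(x)))\,dx\ge0$ for every convex $\varphi:[0,\infty)\to\mathbb{R}$ for which this integral is well defined. *)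

(* Defs.v *)
From HB Require Import structures.
From mathcomp Require Import all_boot all_order all_algebra.
From mathcomp Require Import all_classical all_reals all_analysis.
From mathcomp Require Import measurable_realfun.

Set Implicit Arguments.
Unset Strict Implicit.
Unset Printing Implicit Defensive.

Import Order.TTheory GRing.Theory Num.Theory.
Import numFieldNormedType.Exports.

Local Open Scope classical_set_scope.
Local Open Scope ring_scope.

(* Row vectors carry the sigma-algebra generated by the coordinate maps, as
   n-tuples do in the library; for real entries it is the Borel one. *)
Definition measure_rV_display : measure_display.
Proof. exact: measure_tuple_display default_measure_display. Qed.

Section measurable_rV.
Context {R : realType} (n : nat).

Let coords : 'I_n -> 'rV[R]_n -> measurableTypeR R := fun i x => x ord0 i.

Let rV_set0 : g_sigma_preimage coords set0.
Proof. exact: sigma_algebra0. Qed.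

Let rV_setC A : g_sigma_preimage coords A -> g_sigma_preimage coords (~` A).
Proof. exact: sigma_algebraC. Qed.

Let rV_bigcup (F : _^nat) : (forall i, g_sigma_preimage coords (F i)) ->
  g_sigma_preimage coords (\bigcup_i (F i)).
Proof. exact: sigma_algebra_bigcup. Qed.

HB.instance Definition _ := @isMeasurable.Build measure_rV_display
  'rV[R]_n (g_sigma_preimage coords) rV_set0 rV_setC rV_bigcup.

Lemma measurable_coord (i : 'I_n) :
  measurable_fun [set: 'rV[R]_n] (fun x => x ord0 i : measurableTypeR R).
Proof.
move=> _ Y mY; rewrite setTI; apply: sub_sigma_algebra => /=.
rewrite -bigcup_seq/=; exists i => /=; first by rewrite mem_index_enum.
by exists Y => //; rewrite setTI.
Qed.

Lemma measurable_fun_coordP d (T : measurableType d) (f : T -> 'rV[R]_n) :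
  (forall i, measurable_fun setT (fun t => f t ord0 i : measurableTypeR R)) ->
  measurable_fun setT f.
Proof.
move=> mf; have sub : g_sigma_preimage (fun i => coords i \o f) `<=` measurable.
  apply: smallest_sub; first exact: sigma_algebra_measurable.
  rewrite -bigcup_seq; apply: bigcup_sub => i _.
  by move=> A [B mB <-]; exact: mf.
move: sub; rewrite g_sigma_preimage_comp => sub _ A mA.
by apply: sub; exists A.
Qed.

End measurable_rV.

Section lebesgue_rV.
Context {R : realType}.

Definition cons_rV n (p : measurableTypeR R * 'rV[R]_n) : 'rV[R]_n.+1 :=
  row_mx (const_mx p.1 : 'rV_1) p.2.

Definition uncons_rV n (x : 'rV[R]_n.+1) : measurableTypeR R * 'rV[R]_n :=
  (x ord0 ord0, \row_i x ord0 (lift ord0 i)).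

Lemma cons_rV0 n p : @cons_rV n p ord0 ord0 = p.1.
Proof.
by rewrite [LHS]mxE; case: split_ordP => k /eqP; rewrite -val_eqE//= mxE.
Qed.

Lemma cons_rVS n p i : @cons_rV n p ord0 (lift ord0 i) = p.2 ord0 i.
Proof.
rewrite [LHS]mxE; case: split_ordP => k /eqP; rewrite -val_eqE/=.
  by rewrite ord1.
by rewrite eqSS => /eqP/val_inj ->.
Qed.

Lemma cons_rVK n : cancel (@cons_rV n) (@uncons_rV n).
Proof.
move=> [a v]; rewrite /uncons_rV cons_rV0; congr pair.
by apply/rowP => i; rewrite mxE cons_rVS.
Qed.

Lemma measurable_cons_rV n : measurable_fun setT (@cons_rV n).
Proof.
apply: measurable_fun_coordP => i; case: (unliftP ord0 i) => [j|] ->.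
  rewrite (_ : (fun t => _) =
      (fun x : 'rV[R]_n => x ord0 j : measurableTypeR R) \o snd).
    by apply: measurableT_comp => //; exact: measurable_coord.
  by apply/funext => p /=; rewrite cons_rVS.
rewrite (_ : (fun t => _) = fst); first exact: measurable_fst.
by apply/funext => p /=; rewrite cons_rV0.
Qed.

Lemma measurable_uncons_rV n : measurable_fun setT (@uncons_rV n).
Proof.
apply/measurable_fun_pairP; split; first exact: measurable_coord.
apply: measurable_fun_coordP => i.
rewrite (_ : (fun t => _) =
  fun x : 'rV[R]_n.+1 => x ord0 (lift ord0 i) : measurableTypeR R).
  exact: measurable_coord.
by apply/funext => x /=; rewrite mxE.
Qed.

Section step.
Variables (n : nat) (mu : {sigma_finite_measure set 'rV[R]_n -> \bar R}).

Definition prod_rV : set 'rV[R]_n.+1 -> \bar R :=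
  pushforward (@lebesgue_measure R \x mu)%E (@cons_rV n).

Let prod_rV0 : prod_rV set0 = 0%E.
Proof. by rewrite /prod_rV /pushforward preimage_set0 measure0. Qed.

Let prod_rV_ge0 A : (0 <= prod_rV A)%E.
Proof. by rewrite /prod_rV /pushforward measure_ge0. Qed.

Let prod_rV_sigma_additive : semi_sigma_additive prod_rV.
Proof.
have mcons X : measurable X -> measurable (@cons_rV n @^-1` X).
  by move=> mX; rewrite -[X in measurable X]setTI; exact: measurable_cons_rV.
move=> F mF tF mUF; rewrite /prod_rV /pushforward preimage_bigcup.
apply: measure_semi_sigma_additive.
- by move=> k; exact: mcons.
- apply/trivIsetP => /= i j _ _ ij; rewrite -preimage_setI.
  by move/trivIsetP : tF => /(_ _ _ _ _ ij) ->//; rewrite preimage_set0.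
- by rewrite -preimage_bigcup; exact: mcons.
Qed.

HB.instance Definition _ := isMeasure.Build _ _ _ prod_rV
  prod_rV0 prod_rV_ge0 prod_rV_sigma_additive.

Let prod_rV_sigma_finite : sigma_finite setT prod_rV.
Proof.
have /sigma_finiteP[F [UF ndF mF]] := sigma_finiteT (@lebesgue_measure R).
have /sigma_finiteP[G [UG ndG mG]] := sigma_finiteT mu.
exists (fun k => @uncons_rV n @^-1` (F k `*` G k)).
  rewrite -preimage_bigcup predeqE => x; split=> // _.
  have [k _ Fk] : (\bigcup_i F i) (uncons_rV x).1 by rewrite -UF.
  have [l _ Gl] : (\bigcup_i G i) (uncons_rV x).2 by rewrite -UG.
  exists (maxn k l) => //; split.
  - by move: Fk; exact/subsetPset/ndF/leq_maxl.
  - by move: Gl; exact/subsetPset/ndG/leq_maxr.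
move=> k; have [mFk Fk] := mF k; have [mGk Gk] := mG k; split.
  rewrite -[X in measurable X]setTI; apply: measurable_uncons_rV => //.
  exact: measurableX.
rewrite /prod_rV /pushforward -comp_preimage (_ : _ \o _ = id); last first.
  by apply/funext => p /=; rewrite cons_rVK.
by rewrite preimage_id product_measure1E// lte_mul_pinfty// ge0_fin_numE.
Qed.

HB.instance Definition _ := Measure_isSigmaFinite.Build _ _ _ prod_rV
  prod_rV_sigma_finite.
End step.

Fixpoint lebesgue_rV n : {sigma_finite_measure set 'rV[R]_n -> \bar R} :=
  match n with
  | 0 => \d_(0 : 'rV[R]_0)
  | n.+1 => prod_rV (lebesgue_rV n)
  end.

Lemma lebesgue_rV_box n (A : 'I_n -> set R) :
    (forall i, measurable (A i : set (measurableTypeR R))) ->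
  lebesgue_rV n [set x | forall i, A i (x ord0 i)] =
  (\prod_(i < n) lebesgue_measure (A i))%E.
Proof.
have mbox m (B : 'I_m -> set R) :
    (forall i, measurable (B i : set (measurableTypeR R))) ->
    measurable [set x : 'rV[R]_m | forall i, B i (x ord0 i)].
  move=> mB; rewrite (_ : mkset _ =
      \big[setI/setT]_(i < m) ((fun x : 'rV[R]_m => x ord0 i) @^-1` B i)).
    apply: (@bigsetI_measurable _ 'rV[R]_m) => i _.
    rewrite -[X in measurable X]setTI.
    by apply: measurable_coord => //; exact: mB.
  rewrite -bigcap_seq; apply/seteqP; split=> x Bx i.
    by move=> _; exact: Bx.
  by apply: Bx => /=; rewrite mem_index_enum.
elim: n A => [|n IH] A mA.
  by rewrite big_ord0 /= diracE mem_set// => -[].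
rewrite big_ord_recl -IH//= /prod_rV /pushforward.
rewrite -product_measure1E//; last first.
  by apply: (mbox n (A \o lift ord0)) => i; exact: mA.
congr (product_measure1 _ _ _); apply/seteqP; split=> [p Ap|p [Ap0 ApS] i] /=.
  split; first by have := Ap ord0; rewrite cons_rV0.
  by move=> i; have := Ap (lift ord0 i); rewrite cons_rVS.
by case: (unliftP ord0 i) => [j|] ->; rewrite ?cons_rV0// cons_rVS.
Qed.

End lebesgue_rV.

Section strongly_log_concave.
Context {R : realType} {n : nat}.
Local Open Scope ereal_scope.
Implicit Types (f g : 'rV[R]_n -> R) (V : 'rV[R]_n -> \bar R).

Definition probability_density f :=
  [/\ measurable_fun [set: 'rV[R]_n] f, forall x, (0 <= f x)%R
    & \int[lebesgue_rV n]_x (f x)%:E = 1].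

(* The norm of the library on row vectors is the sup norm, so the Euclidean
   norm is spelled out. *)
Definition gaussian_density (x : 'rV[R]_n) : R :=
  ((2 * pi) `^ (- (n%:R / 2)) * expR (- (\sum_(i < n) x ord0 i ^+ 2) / 2))%R.

(* As V never takes the value -oo, the right-hand side is never +oo - oo. *)
Definition convex_ereal V :=
  (forall x, V x != -oo) /\
  forall (x y : 'rV[R]_n) (t : R), (0 <= t <= 1)%R ->
    V (t *: x + (1 - t) *: y)%R <= t%:E * V x + (1 - t)%:E * V y.

(* f dx = exp(-V) dgamma as measures, i.e. their densities with respect to
   Lebesgue measure agree almost everywhere; a convex V is Lebesgue but not
   always Borel measurable, so the two sides are not compared by integrals. *)
Definition strongly_log_concave f := exists V, convex_ereal V /\
  {ae lebesgue_rV n, forall x,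
    (f x)%:E = expeR (- V x) * (gaussian_density x)%:E}.

Definition integral_defined (h : 'rV[R]_n -> \bar R) :=
  measurable_fun [set: 'rV[R]_n] h /\
  \int[lebesgue_rV n]_x h^\+ x +? - \int[lebesgue_rV n]_x h^\- x.

(* Only the values of phi on [0, +oo[ matter, f and g being nonnegative. *)
Definition majorizes f g := forall phi : R -> R,
  convex_function [set r : R | (0 <= r)%R] phi ->
  integral_defined (fun x => (phi (f x) - phi (g x))%:E) ->
  0 <= \int[lebesgue_rV n]_x (phi (f x) - phi (g x))%:E.

End strongly_log_concave.

(* Main.v *)
Require Import Defs.
From mathcomp Require Import all_boot all_order all_algebra.
From mathcomp Require Import all_classical all_reals all_analysis.
From mathcomp Require Import measurable_realfun ring lra.

Set Implicit Arguments.
Unset Strict Implicit.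
Unset Printing Implicit Defensive.

Import Order.TTheory GRing.Theory Num.Theory.
Import numFieldNormedType.Exports.

Local Open Scope classical_set_scope.
Local Open Scope ring_scope.

                                      

(** Write g for the Gaussian density. Since f and g have the same mass, majorization for the hinges
    max(s - t, 0) says that the integral of min(f, t) is at most that of min(g, t) for every t >= 0.
    The proof establishes this truncated inequality and then passes from hinges to all convex
    functions.

    The truncated inequality ([le_integral_min_gaussian]) is proved for f = P g almost everywhere,
    with P log-concave and f of any mass c, against c g. On the line ([le_integral_min_normal]), c g
    is first translated to some G, which changes no truncated integral. The translation is chosen so
    that f and G have the same mass to the left of the window where G >= t. The ratio f / G is still
    log-concave, because two translates of a Gaussian differ by the exponential of an affine
    function. So either f >= G throughout the window, or f <= G to the right of it; both cases give
    the inequality through [le_integral_min].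

    The dimension is raised by induction. With one coordinate split off as x and the others fixed as
    y, the line case replaces f(x, y) by h(y) times the normal density at x, where h is the marginal
    of f. With x fixed, the induction hypothesis then applies to h, whose ratio to the
    lower-dimensional Gaussian is log-concave by the Prekopa-Leindler inequality
    ([prekopa_leindler], [log_concave_marginal]).

    For a general convex phi ([integral_convex_ge0]), subtract a supporting line at a bound b of g
    and freeze the result beyond b. This gives a nonincreasing convex psi, and the line integrates
    to zero against f - g. Piecewise linear approximations of psi are combinations of truncations
    min(s, t), so summation by parts gives them a nonnegative integral ([integral_interpolant_ge0]).
    Fatou's lemma carries this over to psi ([integral_negpart_le]). *)

(** * Translations and lengths of intervals on the line *)

Lemma ge0_integral_shift (R : realType) (f : R -> \bar R) (s : R) :
  measurable_fun setT f -> (forall x, 0 <= f x)%E ->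
  (\int[@lebesgue_measure R]_x f (x - s)%R = \int[@lebesgue_measure R]_x f x)%E.
Proof.
move=> mf f0.
have ms : measurable_fun [set: measurableTypeR R]
    (fun x : R => x - s : measurableTypeR R).
  exact: measurable_funB.
have E := @ge0_integral_pushforward _ _ _ _ R _ ms lebesgue_measure setT f
  measurableT mf (fun y _ => f0 y).
rewrite preimage_setT in E; rewrite -[LHS]E.
apply/esym; apply: eq_measure_integral => A mA _.
apply: lebesgue_measure_unique => // X [[a b] _ <-] /=.
rewrite /pushforward (_ : _ @^-1` _ = `]a + s, b + s]%classic); last first.
  by apply/seteqP; split=> x /=; rewrite !in_itv /= ltrBrDr lerBlDr.
by rewrite !lebesgue_measure_itv /= !lte_fin ltrD2r -!EFinB opprD addrACA subrr
  addr0.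
Qed.

Section interval_length.
Context {R : realType}.
Notation mu := (@lebesgue_measure R).
Implicit Types I J K : set R.

Lemma lebesgue_measure_interval_le I (a : R) : I !=set0 ->
  (forall x y, I x -> I y -> y - x <= a) -> is_interval I -> (mu I <= a%:E)%E.
Proof.
move=> [x0 Ix0] Ia iI.
have a0 : 0 <= a by have := Ia _ _ Ix0 Ix0; rewrite subrr.
have hs : has_sup I.
  split; [by exists x0|exists (x0 + a) => y Iy].
  by rewrite -lerBlDl; exact: Ia.
have sub : I `<=` `[sup I - a, sup I].
  move=> x Ix /=; rewrite in_itv /=; apply/andP; split;
    last exact: sup_upper_bound.
  rewrite lerBlDr; apply: ge_sup => // [|y Iy]; first by exists x0.
  by rewrite -lerBlDl; exact: Ia.
have mI := is_interval_measurable iI.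
apply: (@le_trans _ _ (mu `[sup I - a, sup I]%classic)).
  by apply: le_measure => //; rewrite inE//.
rewrite lebesgue_measure_itv /= lte_fin; case: ifPn => _; last
  by rewrite lee_fin.
by rewrite -EFinB lee_fin opprB addrC subrK.
Qed.

Lemma lebesgue_measure_interval_ge I (x y : R) : is_interval I -> I x -> I y ->
  ((y - x)%:E <= mu I)%E.
Proof.
move=> iI Ix Iy; have mI := is_interval_measurable iI.
have [yx|xy] := leP y x.
  by apply: (@le_trans _ _ 0%E) => //; rewrite lee_fin subr_le0.
apply: (@le_trans _ _ (mu `[x, y]%classic)).
  by rewrite lebesgue_measure_itv /= lte_fin xy -EFinB.
apply: le_measure; rewrite ?inE// => z /=; rewrite in_itv /=.
exact: iI.
Qed.

(** The length of an interval is the supremum of the differences of its points. Combining a pair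
    from I with a pair from J gives a pair of K; bounding first the differences in I for fixed
    points of J, then those in J, recovers both lengths. *)
Lemma brunn_minkowski_interval I J K (t : R) : 0 < t < 1 ->
  is_interval I -> is_interval J -> is_interval K -> I !=set0 -> J !=set0 ->
  (forall x y, I x -> J y -> K (t * x + (1 - t) * y)) ->
  (t%:E * mu I + (1 - t)%:E * mu J <= mu K)%E.
Proof.
move=> /andP[t0 t1] iI iJ iK I0 J0 IJK; have s0 : 0 < 1 - t by rewrite subr_gt0.
have [Kfin|] := boolP (mu K \is a fin_num); last first.
  by rewrite ge0_fin_numE// -leNgt leye_eq => /eqP ->; rewrite leey.
set k := fine (mu K); have Kk : mu K = k%:E by rewrite fineK.
have step1 x x' y y' : I x -> I x' -> J y -> J y' ->
    t * (x' - x) + (1 - t) * (y' - y) <= k.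
  move=> Ix Ix' Jy Jy'; rewrite -lee_fin -Kk.
  have := lebesgue_measure_interval_ge iK (IJK _ _ Ix Jy) (IJK _ _ Ix' Jy').
  by apply: le_trans; rewrite lee_fin; lra.
have Ia y y' : J y -> J y' -> (mu I <= ((k - (1 - t) * (y' - y)) / t)%:E)%E.
  move=> Jy Jy'; apply: lebesgue_measure_interval_le => // x x' Ix Ix'.
  by rewrite ler_pdivlMr//; have := step1 _ _ _ _ Ix Ix' Jy Jy'; lra.
have Ifin : mu I \is a fin_num.
  case: J0 => y Jy; rewrite ge0_fin_numE//.
  by apply: le_lt_trans (Ia _ _ Jy Jy) _; rewrite ltry.
set a := fine (mu I); have Iaa : mu I = a%:E by rewrite fineK.
have Jb : (mu J <= ((k - t * a) / (1 - t))%:E)%E.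
  apply: lebesgue_measure_interval_le => // y y' Jy Jy'.
  have := Ia _ _ Jy Jy'; rewrite Iaa lee_fin ler_pdivlMr// ler_pdivlMr//.
  by lra.
have Jfin : mu J \is a fin_num.
  by rewrite ge0_fin_numE//; apply: le_lt_trans Jb _; rewrite ltry.
move: Jb; rewrite Kk Iaa -(fineK Jfin) -!EFinM -EFinD !lee_fin ler_pdivlMr//.
by lra.
Qed.

End interval_length.

                                        

(** * Layer cake and the Prekopa-Leindler inequality on the line *)

Lemma measurable_hypograph d (T : measurableType d) (R : realType)
    (w : T -> \bar R) : measurable_fun setT w ->
  measurable [set p : T * measurableTypeR R | (p.2%:E < w p.1)%E].
Proof.
move=> mw; rewrite -[X in measurable X]setTI; apply: measurable_lte => //.
  by apply/measurable_EFinP; exact: measurable_snd.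
by apply: measurableT_comp => //; exact: measurable_fst.
Qed.

Lemma measurable_superlevel_measure d (T : measurableType d) (R : realType)
    (mu : {sigma_finite_measure set T -> \bar R}) (w : T -> \bar R) :
  measurable_fun setT w ->
  measurable_fun [set: R] (fun r : R => mu [set x | (r%:E < w x)%E]).
Proof.
move=> mw; have := measurable_fun_ysection mu (measurable_hypograph mw).
congr (measurable_fun _ _); apply/funext => r /=; congr (mu _).
by apply/seteqP; split=> x; rewrite /ysection /= inE.
Qed.

(** For fixed x, the r in ]0, 1[ with r < w x form an interval of length min(w x, 1); Tonelli on the
    region under the graph does the rest. *)
Lemma layer_cake01 d (T : measurableType d) (R : realType)
    (mu : {sigma_finite_measure set T -> \bar R}) (w : T -> \bar R) :
  measurable_fun setT w -> (forall x, 0 <= w x)%E ->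
  (\int[mu]_x mine (w x) 1 =
   \int[@lebesgue_measure R]_(r in `]0%R, 1%R[) mu [set x | r%:E < w x])%E.
Proof.
move=> mw w0.
pose A : set (T * measurableTypeR R) :=
  [set p | 0 < p.2 < 1 /\ (p.2%:E < w p.1)%E].
have mA : measurable A.
  rewrite (_ : A = (setT `*` `]0, 1[%classic) `&`
      [set p : T * measurableTypeR R | (p.2%:E < w p.1)%E]).
    apply: measurableI; first exact: measurableX.
    exact: measurable_hypograph.
  apply/seteqP; split=> [[x r]|[x r]] /=; rewrite in_itv /=; first by case.
  by move=> [[]].
have mF :
    measurable_fun setT (fun p : T * measurableTypeR R => (\1_A p : R)%:E).
  by apply/measurable_EFinP; exact: measurable_indic.
transitivity (\int[mu]_x \int[@lebesgue_measure R]_r (\1_A (x, r) : R)%:E)%E.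
  apply: eq_integral => x _.
  have -> : (fun r => (\1_A (x, r) : R)%:E) =
      (fun r : R => (\1_([set r | 0 < r < 1 /\ (r%:E < w x)%E]) r)%:E : \bar R).
    by apply/funext => r; rewrite !indicE; congr (_%:R%:E); apply/idP/idP;
      rewrite !inE.
  have [c c01 Ec] : exists2 c : R, 0 <= c <= 1 & mine (w x) 1%E = c%:E.
    have := w0 x; case: (w x) => // [r r0|_].
      exists (Num.min r 1); last by rewrite -EFin_min.
      by rewrite le_min ler01 andbT -lee_fin r0 ge_min lexx orbT.
    by exists 1; rewrite ?lexx ?ler01// min_r// leey.
  rewrite Ec (_ : [set r | _] = `]0, c[%classic); last first.
    apply/seteqP; split=> r /=; rewrite in_itv /=.
      move=> [/andP[-> r1] rw] /=.
      by rewrite -lte_fin -Ec lt_min rw lte_fin r1.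
    move=> /andP[-> ]; rewrite -lte_fin -Ec lt_min => /andP[rw].
    by rewrite lte_fin => ->.
  rewrite integral_indic// setIT [RHS]lebesgue_measure_itv /= lte_fin.
  case: ltP => [_|c0]; first by rewrite oppr0 adde0.
  by congr EFin; apply/le_anti; rewrite c0; case/andP: c01.
rewrite (fubini_tonelli (fun p => (\1_A p : R)%:E))//.
rewrite [RHS]integral_mkcond; apply: eq_integral => r _; rewrite patchE.
case: ifPn => [|] /=; rewrite ?inE ?notin_setE /= in_itv /=.
  move=> r01.
  have -> : (fun x => (\1_A (x, r) : R)%:E) =
      (fun x => (\1_([set x | (r%:E < w x)%E]) x)%:E : \bar R).
    apply/funext => x; rewrite !indicE; congr (_%:R%:E).
    by have [h|h] := pselect (r%:E < w x)%E;
      [rewrite !mem_set|rewrite !memNset// => -[]].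
  rewrite integral_indic// ?setIT//.
  by rewrite -[X in measurable X]setTI; apply: emeasurable_fun_o_infty.
move=> r01; rewrite integral0_eq// => x _; rewrite indicE memNset//.
by case.
Qed.

Section prekopa_leindler.
Context {R : realType}.
Notation mu := (@lebesgue_measure R).
Implicit Types u v w : R -> \bar R.

Definition quasiconcave u := forall r : R, is_interval [set x | (r%:E < u x)%E].

(** This spares any measurability assumption on log-concave functions: they are only ever integrated
    along lines, where they are quasiconcave. *)
Lemma quasiconcave_measurable u : quasiconcave u -> measurable_fun setT u.
Proof.
move=> qu; apply: (measurability _ (ErealGenOInfty.measurableE R)).
move=> _ [_ [r ->] <-]; rewrite setTI.
rewrite (_ : _ @^-1` _ = [set x | (r%:E < u x)%E]); last first.
  by apply/seteqP; split=> x /=; rewrite in_itv/= andbT.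
exact: is_interval_measurable (qu r).
Qed.

(** When u and v both have supremum 1, their superlevel sets are nonempty for every r in ]0, 1[.
    [brunn_minkowski_interval] then applies at each level, and integrating in r yields even the
    arithmetic mean of the integrals. *)
Lemma prekopa_leindler_sup1 u v w (t : R) : 0 < t < 1 ->
  quasiconcave u -> quasiconcave v -> quasiconcave w ->
  (forall x, 0 <= u x <= 1)%E -> (forall x, 0 <= v x <= 1)%E ->
  (forall x, 0 <= w x)%E ->
  (forall r : R, r < 1 -> exists x, (r%:E < u x)%E) ->
  (forall r : R, r < 1 -> exists x, (r%:E < v x)%E) ->
  (forall (r x y : R), 0 < r < 1 -> (r%:E < u x)%E -> (r%:E < v y)%E ->
     (r%:E <= w (t * x + (1 - t) * y)%R)%E) ->
  (t%:E * \int[mu]_x u x + (1 - t)%:E * \int[mu]_x v x <= \int[mu]_x w x)%E.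
Proof.
move=> t01 qu qv qw u01 v01 w0 su sv uvw; have /andP[t0 t1] := t01.
have cake (h : R -> \bar R) : quasiconcave h -> (forall x, 0 <= h x <= 1)%E ->
   (\int[mu]_x h x = \int[mu]_(r in `]0%R, 1%R[) mu [set x | r%:E < h x])%E.
  move=> qh h01; rewrite -layer_cake01//; first last.
  - by move=> x; case/andP: (h01 x).
  - exact: quasiconcave_measurable.
  by apply: eq_integral => x _; rewrite min_l//; case/andP: (h01 x).
have mw := quasiconcave_measurable qw.
(* Cutting w at height 1 lets all three functions be layered over the same levels. *)
apply: (@le_trans _ _ (\int[mu]_x mine (w x) 1)%E); last first.
  apply: ge0_le_integral => //.
  - by move=> x _; rewrite le_min w0 lee01.
  - exact: measurable_mine.
  - by move=> x _; rewrite ge_min lexx.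
rewrite (cake u)// (cake v)// layer_cake01//.
have ml (h : R -> \bar R) : quasiconcave h ->
    measurable_fun (`]0%R, 1%R[%classic : set R)
      (fun r : R => mu [set x | (r%:E < h x)%E]).
  move=> qh; apply: (measurable_funS measurableT) => //.
  by apply: measurable_superlevel_measure; exact: quasiconcave_measurable.
have s0 : 0 < 1 - t by rewrite subr_gt0.
have t0' := ltW t0; have s0' := ltW s0.
rewrite -!ge0_integralZl_EFin//; [|exact: ml..].
rewrite -ge0_integralD//; first last.
- by apply: measurable_funeM; exact: ml.
- by move=> r _; rewrite mule_ge0// lee_fin ltW.
- by apply: measurable_funeM; exact: ml.
- by move=> r _; rewrite mule_ge0// lee_fin ltW.
apply: ge0_le_integral => //.
- by move=> r _; rewrite adde_ge0// mule_ge0// lee_fin ltW.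
- by apply: emeasurable_funD; apply: measurable_funeM; exact: ml.
- exact: ml.
move=> r; rewrite /= in_itv /= => /andP[r0 r1].
apply: brunn_minkowski_interval => //; [exact: su|exact: sv|].
move=> x y /= ux vy.
(* The hypothesis only bounds w weakly from below; a common level c above r turns this into the
   strict bound r < w. *)
have [c rc [cu cv]] : exists2 c : R, r < c & (c%:E < u x /\ c%:E < v y)%E.
  have u1 := u01 x; have v1 := v01 y.
  have ufin : u x \is a fin_num.
    by case/andP: u1 => u0 u1; rewrite ge0_fin_numE// (le_lt_trans u1) ?ltry.
  have vfin : v y \is a fin_num.
    by case/andP: v1 => v0 v1; rewrite ge0_fin_numE// (le_lt_trans v1) ?ltry.
  move: ux vy; rewrite -(fineK ufin) -(fineK vfin) !lte_fin => ux vy.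
  have : r < Num.min (fine (u x)) (fine (v y)) by rewrite lt_min ux.
  move=> /midf_lt[rc]; rewrite lt_min => /andP[cu cv].
  by eexists; [exact: rc|rewrite !lte_fin].
apply: lt_le_trans (uvw c _ _ _ cu cv); first by rewrite lte_fin.
rewrite (lt_trans r0 rc) -lte_fin; apply: lt_le_trans cu _.
by case/andP: (u01 x).
Qed.

Lemma quasiconcave_scale u (c : R) : 0 < c -> quasiconcave u ->
  quasiconcave (fun x => c%:E * u x)%E.
Proof.
move=> c0 qu r; rewrite (_ : mkset _ = [set x | ((c^-1 * r)%:E < u x)%E]);
  first exact: qu.
by apply/seteqP; split=> x /=; rewrite EFinM lte_pdivrMl.
Qed.

Lemma quasiconcave_min u (c : R) : quasiconcave u ->
  quasiconcave (fun x => mine (u x) c%:E).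
Proof.
move=> qu r x y /=; rewrite !lt_min => /andP[ux rc] /andP[uy _] z xyz.
by rewrite /= lt_min rc (qu r _ _ ux uy z xyz).
Qed.

Lemma ge0_integral_min_gt d (T : measurableType d)
    (m : {measure set T -> \bar R}) (u : T -> \bar R) (a : \bar R) :
  measurable_fun setT u -> (forall x, 0 <= u x)%E -> (a < \int[m]_x u x)%E ->
  exists k : nat, (a < \int[m]_x mine (u x) k%:R%:E)%E.
Proof.
move=> mu0 u0 au.
have E : (\int[m]_x u x = \int[m]_x limn (fun k : nat => mine (u x) k%:R%:E))%E.
  apply: eq_integral => x _; apply/esym/cvg_lim => //.
  have := u0 x; case: (u x) => // [r|_].
    rewrite lee_fin => r0; apply: cvg_near_cst; near=> k;
      rewrite min_l// lee_fin.
    by near: k; exact: nbhs_infty_ger.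
  rewrite (_ : (fun k : nat => _) = (fun k : nat => k%:R%:E)); last first.
    by apply/funext => k; rewrite min_r// leey.
  exact/cvgeryP/cvgr_idn.
move: au; rewrite E monotone_convergence//; first last.
- move=> x _ i j ij; rewrite le_min ge_min lexx /= ge_min.
  by rewrite lee_fin ler_nat ij orbT.
- by move=> n x _; rewrite le_min u0 lee_fin ler0n.
- by move=> n; apply: measurable_mine.
move=> au; apply/not_existsP => H; move: au; apply/negP; rewrite -leNgt.
apply: lime_le.
  apply: ereal_nondecreasing_is_cvgn => i j ij; apply: ge0_le_integral => //.
  - by move=> x _; rewrite le_min u0 lee_fin ler0n.
  - exact: measurable_mine.
  - exact: measurable_mine.
  - by move=> x _; rewrite le_min ge_min lexx /= ge_min lee_fin ler_nat ij orbT.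
by apply: nearW => k; rewrite leNgt; apply/negP; exact: H.
Unshelve. all: by end_near. Qed.

(** Cut u at a height k large enough to keep the integral above [expR a], then divide by the
    supremum S of the result; c is [ln S]. The cut makes S finite even when u is unbounded or takes
    the value +oo. *)
Lemma exists_normalized_truncation u (a : R) :
  quasiconcave u -> (forall x, 0 <= u x)%E ->
  ((expR a)%:E < \int[mu]_x u x)%E ->
  exists c : R, exists u' : R -> \bar R,
  [/\ quasiconcave u', forall x, (0 <= u' x <= 1)%E,
      forall r : R, r < 1 -> exists x, (r%:E < u' x)%E,
      forall (r x : R), 0 < r -> (r%:E < u' x)%E -> ((r * expR c)%:E < u x)%E &
      ((expR (a - c))%:E < \int[mu]_x u' x)%E].
Proof.
move=> qu u0 au; have mfu := quasiconcave_measurable qu.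
have [k ak] := @ge0_integral_min_gt _ _ mu u _ mfu u0 au.
pose m x := mine (u x) k%:R%:E.
have m0 x : (0 <= m x)%E by rewrite le_min u0 lee_fin ler0n.
have mfin x : m x \is a fin_num.
  by rewrite ge0_fin_numE// gt_min ltry orbT.
have qm : quasiconcave m by exact: quasiconcave_min.
have mm := quasiconcave_measurable qm.
pose S := sup (range (fun x => fine (m x))).
have hs : has_sup (range (fun x => fine (m x))).
  split; first by exists (fine (m 0)), 0.
  exists k%:R => _ [x _ <-]; rewrite -lee_fin fineK//.
  by rewrite /m ge_min lexx orbT.
have mS x : (m x <= S%:E)%E.
  by rewrite -(fineK (mfin x)) lee_fin; apply: sup_upper_bound => //; exists x.
have S0 : 0 < S.
  rewrite ltNge; apply/negP => S0; move: ak; apply/negP; rewrite -leNgt.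
  rewrite integral0_eq ?lee_fin ?expR_ge0// => x _.
  by apply/le_anti; rewrite m0 andbT (le_trans (mS x)).
exists (ln S), (fun x => S^-1%:E * m x)%E; have iS : 0 < S^-1
  by rewrite invr_gt0.
split.
- exact: quasiconcave_scale.
- move=> x; apply/andP; split; first by rewrite mule_ge0// lee_fin ltW.
  by rewrite lee_pdivrMl// mule1.
- move=> r r1; have [_ [x _ <-] rx] :
      exists2 y, range (fun x => fine (m x)) y & r * S < y.
    by apply: sup_gt; [case: hs|rewrite gtr_pMl].
  exists x; rewrite lte_pdivlMl// -(fineK (mfin x)) -EFinM lte_fin.
  by rewrite mulrC.
- move=> r x r0; rewrite lnK ?posrE// lte_pdivlMl// mulrC.
  by rewrite EFinM lt_min => /andP[].
- rewrite ge0_integralZl_EFin ?ltW// expRB lnK ?posrE// mulrC EFinM.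
  by rewrite lte_pmul2l.
Qed.

(** Strict lower bounds [expR a] and [expR b] stand for the values of u, v and their integrals,
    which avoids powers and products of extended reals. Normalize u and v, apply the case of
    supremum 1, and undo the scaling. *)
Lemma prekopa_leindler u v w (t a b : R) : 0 < t < 1 ->
  quasiconcave u -> quasiconcave v -> quasiconcave w ->
  (forall x, 0 <= u x)%E -> (forall x, 0 <= v x)%E -> (forall x, 0 <= w x)%E ->
  (forall (a b x y : R), ((expR a)%:E < u x)%E -> ((expR b)%:E < v y)%E ->
     ((expR (t * a + (1 - t) * b))%:E <= w (t * x + (1 - t) * y)%R)%E) ->
  ((expR a)%:E < \int[mu]_x u x)%E -> ((expR b)%:E < \int[mu]_x v x)%E ->
  ((expR (t * a + (1 - t) * b))%:E <= \int[mu]_x w x)%E.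
Proof.
move=> t01 qu qv qw u0 v0 w0 uvw au bv; have /andP[t0 t1] := t01.
have s0 : 0 < 1 - t by rewrite subr_gt0.
have [c [u' [qu' u'01 su' uu' au']]] := exists_normalized_truncation qu u0 au.
have [d [v' [qv' v'01 sv' vv' bv']]] := exists_normalized_truncation qv v0 bv.
(* Scaling w by e compensates the normalizing factors [expR c] of u and [expR d] of v. *)
pose e := expR (- (t * c + (1 - t) * d)).
have e0 : 0 < e by exact: expR_gt0.
have ew0 x : (0 <= e%:E * w x)%E by rewrite mule_ge0// lee_fin ltW.
have := @prekopa_leindler_sup1 u' v' (fun x => e%:E * w x)%E t t01 qu' qv'
  (quasiconcave_scale e0 qw) u'01 v'01 ew0 su' sv'.
have mw := quasiconcave_measurable qw.
have e0' := ltW e0; rewrite ge0_integralZl_EFin//.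
have -> : t * a + (1 - t) * b =
  t * c + (1 - t) * d + (t * (a - c) + (1 - t) * (b - d)) by ring.
move=> H; rewrite expRD EFinM -lee_pdivlMl ?expR_gt0// -expRN.
apply: le_trans (H _); last first.
  move=> r x y /andP[r0 r1] rx ry.
  have rE : expR (ln r) = r by rewrite lnK// posrE.
  have ru : ((expR (ln r + c))%:E < u x)%E by rewrite expRD rE; exact: uu'.
  have rv : ((expR (ln r + d))%:E < v y)%E by rewrite expRD rE; exact: vv'.
  apply: le_trans (lee_wpmul2l _ (uvw _ _ _ _ ru rv)); last
    by rewrite lee_fin ltW.
  rewrite -EFinM lee_fin /e -expRD -{1}rE ler_expR le_eqVlt.
  by apply/orP; left; apply/eqP; ring.
(* Convexity of the exponential brings the arithmetic mean down to the geometric one. *)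
apply: (@le_trans _ _
  (t%:E * (expR (a - c))%:E + (1 - t)%:E * (expR (b - d))%:E)%E).
  rewrite -!EFinM -EFinD lee_fin.
  have := @convex_expR R (Itv01 (ltW t0) (ltW t1)) (a - c) (b - d).
  by rewrite !convRE /=.
by apply: leeD; apply: lee_wpmul2l; rewrite ?lee_fin ltW.
Qed.
End prekopa_leindler.

                  

(** * Quantiles of a finite density on the line *)

Section quantile.
Context {R : realType}.
Notation mu := (@lebesgue_measure R).

(** The intermediate value theorem for the distribution function, which is continuous as an integral
    with variable endpoint. *)
Lemma quantile (f : R -> R) (c k : R) : measurable_fun setT f ->
  (forall x, 0 <= f x) -> (\int[mu]_x (f x)%:E = c%:E)%E -> 0 < k < c ->
  exists y : R, (\int[mu]_(x in `]-oo, y[) (f x)%:E = k%:E)%E.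
Proof.
move=> mf f0 fc /andP[k0 kc].
have mE : measurable_fun [set: R] (fun x => (f x)%:E) by exact/measurable_EFinP.
have mED (D : set R) : measurable_fun D (fun x => (f x)%:E).
  exact: measurable_funTS.
pose I (D : set R) := (\int[mu]_(x in D) (f x)%:E)%E.
have I0 D : (0 <= I D)%E by apply: integral_ge0 => x _; rewrite lee_fin.
have Ile (D : set R) : measurable D -> (I D <= c%:E)%E.
  by move=> mD; rewrite -fc; apply: ge0_subset_integral => // x _;
    rewrite lee_fin.
have Ifin (D : set R) : measurable D -> I D \is a fin_num.
  by move=> mD; rewrite ge0_fin_numE// (le_lt_trans (Ile _ mD))// ltry.
have IU (A B : set R) : measurable A -> measurable B -> [disjoint A & B] ->
    I (A `|` B) = (I A + I B)%E.
  move=> mA mB AB; rewrite /I (ge0_integral_setU mu mA mB) //.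
    exact: mED.
  by move=> x _; rewrite lee_fin.
have lim (F : nat -> set R) (r : R) :
    {homo F : n m / (n <= m)%N >-> (n <= m)%O} ->
    (forall n, measurable (F n)) -> \bigcup_n F n = setT -> r < c ->
    exists n, (r%:E < I (F n))%E.
  move=> Fnd mF FT rc; apply/not_existsP => H.
  have cv : ((fun n => I (F n)) @ \oo --> c%:E)%classic.
    rewrite -fc -FT.
    have := @ge0_nondecreasing_set_cvg_integral _ (measurableTypeR R) R F
      (fun x => (f x)%:E) mu Fnd mF (fun n => mED (F n)).
    by apply; move=> n x _; rewrite lee_fin.
  have : (c%:E <= r%:E)%E.
    rewrite -(cvg_lim _ cv)//; apply: lime_le; first exact: cvgP cv.
    by apply: nearW => n; rewrite leNgt; apply/negP/H.
  by rewrite lee_fin leNgt rc.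
have [n1 kn1] : exists n : nat, (k%:E < I `]-oo, n%:R%R[%classic)%E.
  apply: lim => //.
    move=> n m nm; apply/subsetPset => x /=;
      rewrite !in_itv /= => /lt_le_trans -> //.
    by rewrite ler_nat.
  rewrite -subTset => x _; exists (Num.truncn x).+1 => //=.
  by rewrite in_itv /= truncnS_gt.
(* More than c - k of the mass lies to the right of this point, hence less than k to its left. *)
have [n0 kn0] : exists n : nat, ((c - k)%:E < I `[(- n%:R)%R, +oo[%classic)%E.
  apply: lim => //.
    move=> n m nm; apply/subsetPset => x /=; rewrite !in_itv /= !andbT;
      apply: le_trans.
    by rewrite lerN2 ler_nat.
    rewrite -subTset => x _; exists (Num.truncn (- x)).+1 => //=.
    by rewrite in_itv /= andbT lerNl ltW// truncnS_gt.
  by rewrite ltrBlDr ltrDl.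
set a : R := - n0%:R in kn0 *; set b : R := n1%:R in kn1 *.
have Ia : (I `]-oo, a[%classic < k%:E)%E.
  have cE : (c%:E = I `]-oo, a[%classic + I `[a, +oo[%classic)%E.
    rewrite -IU//; first last.
      apply/disj_setPS => x /= []; rewrite !in_itv /= andbT => xa.
      by rewrite leNgt xa.
    rewrite -fc /I; congr (integral mu _ _); apply/esym.
    rewrite -subTset => x _ /=; rewrite !in_itv /= andbT.
    by case: (ltP x a) => _; [left|right].
  have Af : I `]-oo, a[%classic \is a fin_num by exact: Ifin.
  have Bf : I `[a, +oo[%classic \is a fin_num by exact: Ifin.
  move: kn0 cE; rewrite -(fineK Af) -(fineK Bf) -EFinD !lte_fin => B [E].
  by rewrite E in B; lra.
have ab : a <= b.
  rewrite leNgt; apply/negP => ba; have := lt_trans Ia kn1; apply/negP;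
    rewrite -leNgt.
  apply: ge0_subset_integral => //;
    [exact: mED|by move=> x _; rewrite lee_fin|].
  by move=> x /=; rewrite !in_itv /= => /lt_trans; exact.
have IE y : a <= y -> (I `]-oo, y]%classic =
    I `]-oo, a[%classic + I `[a, y]%classic)%E.
  move=> ay; rewrite -IU//.
    congr I; apply/seteqP; split=> x /=; rewrite !in_itv /=.
      by move=> ->; rewrite andbT; case: (ltP x a) => _; [left|right].
    by move=> [/ltW /le_trans ->|/andP[]].
  apply/disj_setPS => x /= []; rewrite !in_itv /= => xa.
  by rewrite leNgt xa.
pose H y := fine (I `]-oo, a[%classic) + parameterized_integral mu a y f.
have HE y : a <= y -> I `]-oo, y]%classic = (H y)%:E.
  move=> ay; rewrite IE// EFinD fineK ?Ifin//; congr (_ + _)%E.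
  by rewrite /parameterized_integral /Rintegral fineK// Ifin.
have [y yab Hy] : exists2 y, y \in `[a, b] & H y = k.
  apply: IVT => //.
    have fab : mu.-integrable `[a, b] (EFin \o f).
      apply/integrableP; split; first exact: mED.
      under eq_integral => x _ do rewrite /= ger0_norm//.
      by rewrite -/(I `[a, b]%classic) -ge0_fin_numE ?Ifin.
    move=> x; apply: (@cvgD _ R^o); first exact: cvg_cst.
    exact: (parameterized_integral_continuous ab fab).
  have Hak : H a <= k.
    rewrite -lee_fin -HE// /I -integral_itv_bndo_bndc; [exact: ltW|exact: mED].
  have Hbk : k <= H b.
    rewrite -lee_fin -HE// /I -integral_itv_bndo_bndc; [exact: ltW|exact: mED].
  by rewrite ge_min Hak le_max Hbk orbT.
exists y; rewrite integral_itv_bndo_bndc; last exact: mED.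
by rewrite -Hy -HE//; move: yab; rewrite in_itv /= => /andP[].
Qed.
End quantile.

                              

(** * A criterion for truncated integrals, and log-concave functions *)

(** On E, truncation can only lower f and leaves g unchanged, so the comparison of masses suffices.
    Off E, the truncations are ordered pointwise almost everywhere. *)
Lemma le_integral_min d (T : measurableType d) (R : realType)
    (mu : {measure set T -> \bar R}) (f g : T -> R) (E : set T) (t : R) :
  measurable E -> measurable_fun setT f -> measurable_fun setT g ->
  (forall x, 0 <= f x) -> (forall x, 0 <= g x) -> 0 <= t ->
  (\int[mu]_(x in E) (f x)%:E <= \int[mu]_(x in E) (g x)%:E)%E ->
  (forall x, E x -> g x <= t) ->
  {ae mu, forall x, ~ E x -> (t <= g x) || (f x <= g x)} ->
  (\int[mu]_x (Num.min (f x) t)%:E <= \int[mu]_x (Num.min (g x) t)%:E)%E.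
Proof.
move=> mE mf mg f0 g0 t0 fg gt ae.
have mm (h : T -> R) D : measurable_fun setT h ->
    measurable_fun D (fun x => (Num.min (h x) t)%:E).
  by move=> mh; apply: measurable_funTS; apply/measurable_EFinP;
    exact: measurable_minr.
have m0 (h : T -> R) x : (forall x, 0 <= h x) -> (0 <= (Num.min (h x) t)%:E)%E.
  by move=> h0; rewrite lee_fin le_min h0.
have split (h : T -> R) : measurable_fun setT h -> (forall x, 0 <= h x) ->
    (\int[mu]_x (Num.min (h x) t)%:E = \int[mu]_(x in E) (Num.min (h x) t)%:E +
      \int[mu]_(x in ~` E) (Num.min (h x) t)%:E)%E.
  move=> mh h0; rewrite -ge0_integral_setU//.
  - by rewrite setUv.
  - exact: measurableC.
  - exact: mm.
  - by move=> x _; exact: m0.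
  - by apply/disj_setPS => x [].
rewrite split// (split g)//; apply: leeD.
  apply: (@le_trans _ _ (\int[mu]_(x in E) (f x)%:E)%E).
    apply: ge0_le_integral => //.
    - by move=> x _; exact: m0.
    - exact: mm.
    - by apply/measurable_EFinP; exact: measurable_funTS.
    - by move=> x _; rewrite lee_fin ge_min lexx.
  apply: le_trans fg _; rewrite le_eqVlt; apply/orP; left; apply/eqP.
  by apply: eq_integral => x /set_mem Ex; rewrite min_l// gt.
apply: ae_ge0_le_integral => //.
- exact: measurableC.
- by move=> x _; exact: m0.
- exact: mm.
- by move=> x _; exact: m0.
- exact: mm.
apply: filterS ae => x H nE; have {H nE} := H nE.
by rewrite lee_fin le_min !ge_min lexx orbT andbT orbC.
Qed.

Section log_concave.
Context {R : realType}.

                                                                            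
                                                                  
(** Multiplicative concavity tested on strict exponential lower bounds: a zero of P makes the
    condition vacuous, the value +oo is allowed, and the form is exactly the one that
    [prekopa_leindler] preserves. *)
Definition log_concave (E : lmodType R) (P : E -> \bar R) :=
  (forall x, 0 <= P x)%E /\
  forall (x y : E) (t a b : R), 0 < t < 1 ->
    ((expR a)%:E < P x)%E -> ((expR b)%:E < P y)%E ->
    ((expR (t * a + (1 - t) * b))%:E <= P (t *: x + (1 - t) *: y)%R)%E.

Lemma log_concave_expRM (E : lmodType R) (P : E -> \bar R) (l : E -> R) :
  (forall (x y : E) (t : R), 0 < t < 1 ->
     t * l x + (1 - t) * l y <= l (t *: x + (1 - t) *: y)) ->
  log_concave P -> log_concave (fun x => (expR (l x))%:E * P x)%E.
Proof.
move=> lc [P0 Plc]; split=> [x|x y t a b t01].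
  by rewrite mule_ge0// lee_fin expR_ge0.
have sc z c : ((expR c)%:E < (expR (l z))%:E * P z)%E =
    ((expR (c - l z))%:E < P z)%E.
  by rewrite -lte_pdivrMl ?expR_gt0// -EFinM -expRN -expRD addrC.
rewrite !sc => /Plc H /H {H} /(_ t t01) H.
rewrite -lee_pdivrMl ?expR_gt0// -EFinM -expRN -expRD.
by apply: le_trans H; rewrite lee_fin ler_expR; have := lc x y t t01; lra.
Qed.

Lemma exists_expR_between (r : R) (p q : \bar R) : 0 <= r ->
  (r%:E < p)%E -> (r%:E < q)%E ->
  exists a : R, [/\ r < expR a, ((expR a)%:E < p)%E & ((expR a)%:E < q)%E].
Proof.
(* The cap [r + 1] keeps the minimum finite when both p and q are +oo; the exponential is then the
   midpoint between r and that minimum. *)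
move=> r0 rp rq; have : (r%:E < mine (mine p q) (r + 1)%:E)%E.
  by rewrite !lt_min rp rq lte_fin ltrDl ltr01.
have : mine (mine p q) (r + 1)%:E \is a fin_num.
  rewrite fin_numE; apply/andP; split.
    by rewrite gt_eqF// (lt_trans (ltNyr r))// !lt_min rp rq lte_fin ltrDl
      ltr01.
  by rewrite lt_eqF// gt_min ltry orbT.
move=> /fineK E; rewrite -E lte_fin => /midf_lt[rm mm].
exists (ln ((r + fine (mine (mine p q) (r + 1)%:E)) / 2)).
rewrite lnK ?posrE ?(le_lt_trans r0 rm)//.
by move: mm; rewrite -lte_fin E !lt_min => /andP[/andP[]].
Qed.

Lemma log_concave_quasiconcave (P : R^o -> \bar R) : log_concave P ->
    quasiconcave P.
Proof.
move=> [P0 Plc] r x y /= rx ry z /andP[xz zy].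
have [r0|r0] := ltP r 0; first by rewrite /= (lt_le_trans _ (P0 z)).
have [a [ra ax ay]] := exists_expR_between r0 rx ry.
rewrite /= (lt_le_trans (y := (expR a)%:E)) ?lte_fin//.
move: xz; rewrite le_eqVlt => /predU1P[<-|xz]; first exact: ltW.
move: zy; rewrite le_eqVlt => /predU1P[->|zy]; first exact: ltW.
pose t := (y - z) / (y - x).
have yx : 0 < y - x by rewrite subr_gt0 (lt_trans xz).
have t01 : 0 < t < 1.
  apply/andP; split; first by rewrite divr_gt0// subr_gt0.
  by rewrite /t ltr_pdivrMr// mul1r ltrD2l ltrN2.
have := Plc _ _ t _ _ t01 ax ay.
rewrite -mulrDl addrC subrK mul1r.
rewrite (_ : t *: (x : R^o) + (1 - t) *: (y : R^o) = z)//.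
by rewrite /GRing.scale /= /t; field; rewrite gt_eqF.
Qed.

End log_concave.

Lemma lt_integral_ae d (T : measurableType d) (R : realType)
    (mu : {measure set T -> \bar R}) (D : set T) (f g : T -> R) :
  measurable D -> mu D != 0%E -> measurable_fun setT f ->
    measurable_fun setT g ->
  (forall x, 0 <= f x) -> (forall x, 0 <= g x) ->
  (\int[mu]_(x in D) (f x)%:E < +oo)%E ->
  {ae mu, forall x, D x -> f x < g x} ->
  (\int[mu]_(x in D) (f x)%:E < \int[mu]_(x in D) (g x)%:E)%E.
Proof.
move=> mD D0 mf mg f0 g0 foo fg; rewrite ltNge; apply/negP => gf.
pose h x := Num.max (g x - f x) 0.
have mE (k : T -> R) : measurable_fun setT k -> measurable_fun D (EFin \o k).
  by move=> mk; apply/measurable_funTS/measurable_EFinP.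
have mh : measurable_fun setT h.
  by apply: measurable_maxr => //; exact: measurable_funB.
have h0 x : (0 <= (h x)%:E)%E by rewrite lee_fin le_max lexx orbT.
have E : (\int[mu]_(x in D) (g x)%:E =
    \int[mu]_(x in D) (f x)%:E + \int[mu]_(x in D) (h x)%:E)%E.
  rewrite -ge0_integralD//; first last.
  - exact: mE.
  - exact: mE.
  - by move=> x _; rewrite lee_fin.
  apply: ge0_ae_eq_integral => //.
  - exact: mE.
  - by apply: emeasurable_funD; exact: mE.
  - by move=> x _; rewrite lee_fin.
  - by move=> x _; rewrite adde_ge0// lee_fin.
  apply: filterS fg => x fg Dx; rewrite -EFinD; congr EFin.
  by rewrite /h max_l ?subr_ge0 ?(ltW (fg Dx))// addrC subrK.
have h_eq0 : (\int[mu]_(x in D) (h x)%:E = 0)%E.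
  apply/le_anti; rewrite integral_ge0 ?andbT//.
  have fin : (\int[mu]_(x in D) (f x)%:E)%E \is a fin_num.
    by rewrite ge0_fin_numE//; apply: integral_ge0 => x _; rewrite lee_fin.
  by move: gf; rewrite E -[leRHS]adde0 leeD2lE.
have /(ae_eq_integral_abs mu mD (mE _ mh)) hae :
    (\int[mu]_(x in D) `|(h x)%:E| = 0)%E.
  by rewrite -h_eq0; apply: eq_integral => x _; rewrite gee0_abs.
have : mu.-negligible D.
  apply: negligibleS (filterI fg hae) => x Dx /= [/(_ Dx) fgx /(_ Dx)].
  by rewrite /h max_l ?subr_ge0 ?ltW// => -[] /eqP; rewrite subr_eq0 gt_eqF.
by rewrite negligibleP// => /eqP; apply/negP.
Qed.

(** A concave logarithm that is nonnegative at p and positive at x is nonnegative in between. *)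
Lemma log_concave_cross (R : realType) (P : R^o -> \bar R) (p q x : R) :
  log_concave P -> p < q < x -> (1 <= P p)%E -> (1 < P x)%E -> (1 <= P q)%E.
Proof.
move=> [P0 Plc] /andP[pq qx] Pp Px.
have [b [b1 bx _]] := exists_expR_between ler01 Px Px.
have b0 : 0 < b by rewrite -ltr_expR expR0.
pose t := (x - q) / (x - p).
have px : 0 < x - p by rewrite subr_gt0 (lt_trans pq).
have t0 : 0 < t by rewrite divr_gt0// subr_gt0.
have t1 : t < 1 by rewrite /t ltr_pdivrMr// mul1r ltrD2l ltrN2.
(* As [log_concave] wants a strict bound and P may equal 1 at p, spend the slack b > 0 available at
   x: this negative exponent at p balances b exactly, so the combination is 0. *)
have ap : ((expR (- ((1 - t) * b / t)))%:E < P p)%E.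
  apply: lt_le_trans Pp; rewrite lte_fin expR_lt1 oppr_lt0.
  by rewrite divr_gt0// mulr_gt0// subr_gt0.
have := Plc _ _ t _ _ _ ap bx.
rewrite t0 t1 => /(_ isT).
rewrite (_ : t * _ + _ = 0); last by field; rewrite gt_eqF.
rewrite expR0 (_ : t *: (p : R^o) + (1 - t) *: (x : R^o) = q)//.
by rewrite /GRing.scale /= /t; field; rewrite gt_eqF.
Qed.

                                       

(** * The truncated inequality on the line *)

Lemma ae_imply d (T : measurableType d) (R : realType)
    (mu : {measure set T -> \bar R}) (P Q : T -> Prop) :
  (forall x, P x -> Q x) -> {ae mu, forall x, P x} -> {ae mu, forall x, Q x}.
Proof. by move=> PQ; apply: negligibleS => x /=; apply: contra_not => /PQ. Qed.

Section one_dimensional.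
Context {R : realType}.
Notation mu := (@lebesgue_measure R).
Local Notation phi := (@normal_pdf R 0 1).
Local Notation K := (@normal_peak R 1).

Lemma normal_pdf01E x : phi x = K * expR (- (x ^+ 2 / 2)).
Proof.
rewrite normal_pdfE ?oner_eq0// /normal_fun subr0 expr1n mulNr.
by rewrite -[1 *+ 2]/(2%:R).
Qed.

Lemma normal_pdf01_gt0 x : 0 < phi x.
Proof. by rewrite normal_pdf01E mulr_gt0 ?expR_gt0// normal_peak_gt0// oner_eq0.
  Qed.

(** Below its peak, a multiple of the normal density has a symmetric interval as superlevel set. *)
Lemma normal_pdf01_ge (c t : R) : 0 < t < c * K ->
  exists2 z : R, 0 <= z & forall x, (t <= c * phi x) = (`|x| <= z).
Proof.
move=> /andP[t0 tcK]; have K0 : 0 < K by rewrite normal_peak_gt0// oner_eq0.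
have cK0 : 0 < c * K := lt_trans t0 tcK.
have l0 : 0 <= 2 * ln (c * K / t).
  by rewrite mulr_ge0// ln_ge0// ler_pdivlMr// mul1r ltW.
exists (Num.sqrt (2 * ln (c * K / t))); first exact: sqrtr_ge0.
move=> x; rewrite normal_pdf01E mulrA -sqrtr_sqr ler_sqrt//.
rewrite -ler_pdivrMl// -[in LHS](@lnK _ (_ * t)); last first.
  by rewrite posrE mulr_gt0// invr_gt0.
rewrite ler_expR -(invrK ((c * K)^-1 * t)) lnV ?posrE ?invr_gt0 ?mulr_gt0
  ?invr_gt0//.
by rewrite invfM invrK lerN2 ler_pdivrMr// mulrC.
Qed.

Lemma integral_normal_pdf01_shift (c s t : R) : 0 <= c -> 0 <= t ->
  (\int[mu]_x (Num.min (c * phi (x - s)) t)%:E =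
   \int[mu]_x (Num.min (c * phi x) t)%:E)%E.
Proof.
move=> c0 t0.
apply: (@ge0_integral_shift _ (fun x => (Num.min (c * phi x) t)%:E)).
  apply/measurable_EFinP; apply: measurable_minr => //.
  by apply: measurable_funM => //; exact: measurable_normal_pdf.
by move=> x; rewrite lee_fin le_min mulr_ge0// normal_pdf_ge0.
Qed.

(** Translate the comparison density so that it has the mass of f to the left of its window of
    values >= t; log-concavity of the ratio then leaves only two configurations, each covered by
    [le_integral_min]. *)
Lemma le_integral_min_normal (f : R -> R) (P : R^o -> \bar R) (c t : R) :
  measurable_fun setT f -> (forall x, 0 <= f x) -> log_concave P ->
  {ae mu, forall x, (f x)%:E = (P x * (phi x)%:E)%E} ->
  (\int[mu]_x (f x)%:E = c%:E)%E -> 0 <= t ->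
  (\int[mu]_x (Num.min (f x) t)%:E <= \int[mu]_x (Num.min (c * phi x) t)%:E)%E.
Proof.
move=> mf f0 lcP fP fc.
have c0 : 0 <= c by rewrite -lee_fin -fc; apply: integral_ge0 => x _;
    rewrite lee_fin.
rewrite le_eqVlt => /predU1P[<-|t0].
  rewrite integral0_eq; last by move=> x _; rewrite min_r.
  apply: integral_ge0 => x _; rewrite lee_fin le_min lexx andbT.
  by rewrite mulr_ge0// ?normal_pdf_ge0.
have t0' := ltW t0.
have phi0 := normal_pdf01_gt0.
have mphi : measurable_fun setT phi by exact: measurable_normal_pdf.
have fmin : (\int[mu]_x (Num.min (f x) t)%:E <= c%:E)%E.
  rewrite -fc; apply: ge0_le_integral => //.
  - by move=> x _; rewrite lee_fin le_min f0.
  - by apply/measurable_EFinP; exact: measurable_minr.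
  - exact/measurable_EFinP.
  - by move=> x _; rewrite lee_fin ge_min lexx.
have cphi (k : R) : 0 <= k -> (\int[mu]_x (k * phi x)%:E = k%:E)%E.
  move=> k0; under eq_integral do rewrite EFinM.
  rewrite ge0_integralZl_EFin//.
  - by rewrite integral_normal_pdf mule1.
  - by move=> x _; rewrite lee_fin ltW.
  - exact/measurable_EFinP.
(* Above the peak [c * K], truncation does not touch the normal side, whose integral is then the
   full mass c. *)
have [cKt|tcK] := leP (c * K) t.
  apply: (le_trans fmin); rewrite -(cphi _ c0) le_eqVlt; apply/orP; left;
    apply/eqP.
  apply: eq_integral => x _; rewrite min_l//; apply: le_trans cKt.
  by rewrite ler_wpM2l// normal_pdf_ub// oner_eq0.
have {}c0 : 0 < c.
  by rewrite lt_neqAle c0 andbT; apply: contraTneq tcK => <-;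
    rewrite mul0r -leNgt.
have c0' := ltW c0.
have [z z0 tz] :
    exists2 z : R, 0 <= z & forall x, (t <= c * phi x) = (`|x| <= z).
  by apply: normal_pdf01_ge; rewrite t0.
have mEphi : measurable_fun setT (fun x => (c * phi x)%:E).
  by apply/measurable_EFinP; exact: measurable_funM.
have cphi0 x : 0 < c * phi x by rewrite mulr_gt0.
have mitv (A : set R) : measurable A ->
    (\int[mu]_(x in A) (c * phi x)%:E \is a fin_num)%E.
  move=> mA; rewrite ge0_fin_numE; last first.
    by apply: integral_ge0 => x _; rewrite lee_fin ltW.
  apply: (@le_lt_trans _ _ c%:E); last exact: ltry.
  rewrite -(cphi _ c0'); apply: ge0_subset_integral => // x _.
  by rewrite lee_fin ltW.
have pos (A : set R) : measurable A -> mu A != 0%E ->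
    (0 < \int[mu]_(x in A) (c * phi x)%:E)%E.
  move=> mA A0; rewrite -(@integral0 _ _ _ mu A).
  apply: (@lt_integral_ae _ _ _ mu A (cst 0) (fun x => c * phi x)) => //.
  - exact: measurable_funM.
  - by move=> x; exact: ltW.
  - by rewrite integral0 ltry.
  - by apply: aeW => x _; exact: cphi0.
have muNy (r : R) : mu `]-oo, r[%classic != 0%E.
  by rewrite lebesgue_measure_itv /= ltNyr.
have muy (r : R) : mu `[r, +oo[%classic != 0%E.
  by rewrite lebesgue_measure_itv /= ltry.
(* k is the mass of the centred density to the left of its window. With y the matching quantile of f
   and s = y + z below, the window of G is [y, s + z] and f, G have equal mass k left of y. *)
pose k := fine (\int[mu]_(x in `]-oo, (- z)%R[) (c * phi x)%:E).
have kE : (\int[mu]_(x in `]-oo, (- z)%R[) (c * phi x)%:E = k%:E)%E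
    by rewrite fineK// mitv.
have kc : 0 < k < c.
  rewrite -!lte_fin -kE pos//=.
  rewrite -(cphi _ c0') (_ :
    setT = `]-oo, (- z)[%classic `|` `[- z, +oo[%classic); last first.
    apply/esym; rewrite -subTset => x _ /=; rewrite !in_itv /= andbT.
    by case: (ltP x (- z)) => _; [left|right].
  rewrite (ge0_integral_setU mu)//; first last.
  - apply/disj_setPS => x /= []; rewrite !in_itv /= andbT => xa.
    by rewrite leNgt xa.
  - by move=> x _; rewrite lee_fin ltW.
  - exact: measurable_funTS.
  by rewrite lteDl ?mitv// pos.
have [y yk] := quantile mf f0 fc kc.
pose s := y + z; pose G x := c * phi (x - s).
have mG : measurable_fun setT G.
  apply: measurable_funM => //; apply: (measurableT_comp mphi).
  exact: measurable_funB.
have G0 x : 0 < G x by rewrite /G mulr_gt0.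
have Gy : (\int[mu]_(x in `]-oo, y[) (G x)%:E = k%:E)%E.
  rewrite -kE integral_mkcond [RHS]integral_mkcond.
  rewrite -[RHS](@ge0_integral_shift _ _ s).
  - apply: eq_integral => x _; rewrite !patchE; congr (if _ then _ else _).
    apply/idP/idP; rewrite !inE /= !in_itv /= /s; lra.
  - exact: ((measurable_restrictT
      (fun x : R => (c * phi x)%:E) (measurable_itv `]-oo, - z[)).1
      (measurable_funTS mEphi)).
  - by move=> x; rewrite patchE; case: ifP => // _; rewrite lee_fin ltW.
have GT : (\int[mu]_x (G x)%:E = c%:E)%E.
  rewrite -(cphi _ c0'); apply: (@ge0_integral_shift _ _ s mEphi) => x.
  by rewrite lee_fin ltW.
                                                                       
                                              
(* The ratio of f to G: P times the exponential of an affine function, hence log-concave. *)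
pose P' : R^o -> \bar R :=
  fun x => ((expR (- (x * s) + s ^+ 2 / 2 - ln c))%:E * P x)%E.
have lcP' : log_concave P'.
  apply: (log_concave_expRM (l := fun x : R^o => - (x * s) + s ^+ 2 / 2 - ln c))
    => // x y' t' _.
  by rewrite /GRing.scale /= le_eqVlt; apply/orP; left; apply/eqP; ring.
have fG : {ae mu, forall x, (f x)%:E = (P' x * (G x)%:E)%E}.
  apply: ae_imply fP => x ->; rewrite /P'.
  have -> : phi x = expR (- (x * s) + s ^+ 2 / 2 - ln c) * G x.
    rewrite /G !normal_pdf01E expRB lnK ?posrE//.
    rewrite (_ : - (x ^+ 2 / 2) = - (x * s) + s ^+ 2 / 2 - (x - s) ^+ 2 / 2);
      last by field.
    by rewrite expRD; field; rewrite gt_eqF.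
  by rewrite EFinM muleA [(P x * _)%E]muleC.
rewrite -(integral_normal_pdf01_shift s c0' t0').
have win x : (t <= G x) = (`|x - s| <= z) by rewrite /G tz.
(* If f >= G almost everywhere on the window, equality of total masses gives f at most the mass of G
   on the complement, where G <= t; this complement is the set E. *)
have [A|] := pselect (forall x, `|x - s| <= z -> (1 <= P' x)%E).
  pose W := `[s - z, s + z]%classic;
    have mW : measurable (W : set (measurableTypeR R)) by exact: measurable_itv.
  have inW x : W x = (`|x - s| <= z) :> Prop.
    rewrite /W /= in_itv /= ler_norml; congr is_true.
    by apply/idP/idP => /andP[? ?]; apply/andP; split; lra.
  have split (h : R -> R) : measurable_fun setT h -> (forall x, 0 <= h x) ->
      (\int[mu]_x (h x)%:E =
        \int[mu]_(x in W) (h x)%:E + \int[mu]_(x in ~` W) (h x)%:E)%E.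
    move=> mh h0; rewrite -(ge0_integral_setU mu)//.
    - by rewrite setUv.
    - exact: measurableC.
    - by apply: measurable_funTS; exact/measurable_EFinP.
    - by move=> x _; rewrite lee_fin.
    - by apply/disj_setPS => x [].
  apply: (@le_integral_min _ _ _ mu f G (~` W)) => //.
  - exact: measurableC.
  - by move=> x; exact: ltW.
  - have WG : (\int[mu]_(x in W) (G x)%:E <= \int[mu]_(x in W) (f x)%:E)%E.
      apply: ae_ge0_le_integral => //.
      + by move=> x _; rewrite lee_fin ltW.
      + by apply: measurable_funTS; exact/measurable_EFinP.
      + by move=> x _; rewrite lee_fin.
      + by apply: measurable_funTS; exact/measurable_EFinP.
      apply: ae_imply fG => x -> Wx; rewrite -[leLHS]mul1e; apply: lee_wpmul2r.
        by rewrite lee_fin ltW.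
      by apply: A; rewrite -inW.
    have Gc := split G mG (fun x => ltW (G0 x)); have Fc := split f mf f0.
    have fin : (\int[mu]_(x in W) (f x)%:E)%E \is a fin_num.
      rewrite ge0_fin_numE; last by apply: integral_ge0 => x _; rewrite lee_fin.
      apply: le_lt_trans (ltry c); rewrite -fc Fc leeDl//.
      by apply: integral_ge0 => x _; rewrite lee_fin.
    by rewrite -(leeD2lE _ _ fin) -Fc fc -GT Gc; exact: leeD2r.
  - by move=> x; rewrite /setC /= inW -win => /negP; rewrite -ltNge => /ltW.
  - by apply: aeW => x /=; rewrite /setC /= inW -win => /contrapT ->.
(* Otherwise the ratio is below 1 at some q of the window, and E is the half-line left of y: equal
   masses and G <= t on it, t <= G on the window, f <= G almost everywhere beyond. *)
move=> /existsNP[q] /not_implyP[qz /negP]; rewrite -ltNge => Pq.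
apply: (@le_integral_min _ _ _ mu f G `]-oo, y[%classic) => //.
- by move=> x; exact: ltW.
- by rewrite yk -Gy.
- move=> x /=; rewrite in_itv /= => xy; rewrite leNgt; apply/negP => /ltW;
    rewrite win.
  by rewrite ler_norml /s; lra.
(* If the ratio exceeded 1 at x beyond the window, then by [log_concave_cross] and the dip at q it
   would be below 1 at every p < y, so f would have strictly less mass than G there. *)
have P'x x : s + z < x -> (P' x <= 1)%E.
  move=> xz; rewrite leNgt; apply/negP => P1x.
  have : (\int[mu]_(x in `]-oo, y[) (f x)%:E <
      \int[mu]_(x in `]-oo, y[) (G x)%:E)%E.
    apply: lt_integral_ae => //.
    - exact: muNy.
    - by move=> ?; exact: ltW.
    - by rewrite yk ltry.
    apply: ae_imply fG => p fp /=; rewrite in_itv /= => py.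
    have Gp0 : (0 < (G p)%:E)%E by rewrite lte_fin.
    rewrite -lte_fin fp -[ltRHS]mul1e lte_pmul2r// ltNge; apply/negP => P1p.
    move: Pq; apply/negP; rewrite -leNgt.
    apply: (log_concave_cross lcP' _ P1p P1x).
    by move: qz; rewrite ler_norml /s; move: xz py; rewrite /s; lra.
  by rewrite yk Gy ltxx.
apply: ae_imply fG => x fx /=; rewrite in_itv /= => /negP; rewrite -leNgt => yx.
have [xz|xz] := leP x (s + z).
  by rewrite win ler_norml; move: xz; rewrite /s; lra.
apply/orP; right; rewrite -lee_fin fx -[leRHS]mul1e; apply: lee_wpmul2r.
  by rewrite lee_fin ltW.
exact: P'x.
Qed.
End one_dimensional.

                                     

(** * Iterated integration on row vectors; product form of the Gaussian *)

Section row_vectors.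
Context {R : realType}.
Notation mu := (@lebesgue_measure R).
Local Notation phi := (@normal_pdf R 0 1).

Lemma cons_rV_comb n (a b x x' : R) (y y' : 'rV[R]_n) :
  a *: cons_rV (x, y) + b *: cons_rV (x', y') =
  cons_rV (a * x + b * x', a *: y + b *: y').
Proof.
apply/rowP => i; rewrite [LHS]mxE [X in X + _]mxE [X in _ + X]mxE.
by case: (unliftP ord0 i) => [j|] ->; rewrite ?cons_rV0// !cons_rVS /= !mxE.
Qed.

Lemma measurable_cons_rV_section n (y : 'rV[R]_n) :
  measurable_fun [set: measurableTypeR R] (fun x : R => cons_rV (x, y)).
Proof.
apply: (measurableT_comp (@measurable_cons_rV R n)).
exact: pair2_measurable.
Qed.

Lemma ge0_integral_rVS n (F : 'rV[R]_n.+1 -> \bar R) :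
  measurable_fun setT F -> (forall z, 0 <= F z)%E ->
  (\int[lebesgue_rV n.+1]_z F z =
   \int[lebesgue_rV n]_y \int[mu]_x F (cons_rV (x, y)))%E.
Proof.
move=> mF F0; have mc := @measurable_cons_rV R n.
transitivity (\int[mu \x lebesgue_rV n]_p (F \o @cons_rV R n) p)%E.
  have := @ge0_integral_pushforward _ _ _ _ R _ mc (mu \x lebesgue_rV n)%E
    setT F measurableT mF (fun y _ => F0 y).
  by rewrite preimage_setT => <-; apply: eq_measure_integral => A mA _.
rewrite fubini_tonelli2//; last by move=> p /=; exact: F0.
exact: measurableT_comp.
Qed.

(** Cover the exceptional set by a measurable null set and integrate its indicator by
    [ge0_integral_rVS]: almost every section has measure zero. *)
Lemma ae_rVS n (A : 'rV[R]_n.+1 -> Prop) :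
  {ae lebesgue_rV n.+1, forall z, A z} ->
  {ae lebesgue_rV n, forall y, {ae mu, forall x, A (cons_rV (x, y))}}.
Proof.
move=> [N [mN N0 AN]].
have mI : measurable_fun setT (fun z => (\1_N z)%:E : \bar R).
  by apply/measurable_EFinP; exact: measurable_indic.
have I0 z : (0 <= (\1_N z)%:E :> \bar R)%E by rewrite lee_fin.
have IN : (\int[lebesgue_rV n.+1]_z (\1_N z)%:E = 0)%E.
  by rewrite integral_indic// setIT; exact: N0.
have := ge0_integral_rVS mI I0; rewrite IN => /esym.
pose h y := (\int[mu]_x (\1_N (cons_rV (x, y)))%:E)%E.
have h0 y : (0 <= h y)%E by apply: integral_ge0 => x _.
have mh : measurable_fun setT h.
  have := @measurable_fun_fubini_tonelli_G _ _ (measurableTypeR R) 'rV[R]_n R mu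
    (fun p => (\1_N (cons_rV p))%:E).
  apply => //; exact: (measurableT_comp mI (@measurable_cons_rV R n)).
have -> : (\int[lebesgue_rV n]_y h y = \int[lebesgue_rV n]_y `|h y|)%E.
  by apply: eq_integral => y _; rewrite gee0_abs.
move=> /(ae_eq_integral_abs _ measurableT mh); apply: ae_imply => y /(_ I).
rewrite /h /= => hy; exists ((fun x => cons_rV (x, y)) @^-1` N).
have mS : measurable ((fun x : measurableTypeR R => cons_rV (x, y)) @^-1` N).
  by rewrite -[X in measurable X]setTI; exact: measurable_cons_rV_section.
split => //; last by move=> x /= /AN.
rewrite -[RHS]hy -[X in mu X]setIT -(integral_indic mu measurableT mS).
by apply: eq_integral => x _; rewrite !indicE.
Qed.

Lemma gaussian_density_ge0 n (x : 'rV[R]_n) : 0 <= gaussian_density x.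
Proof. by rewrite mulr_ge0// ?powR_ge0// expR_ge0. Qed.

Lemma gaussian_density_gt0 n (x : 'rV[R]_n) : 0 < gaussian_density x.
Proof. by rewrite mulr_gt0// ?powR_gt0 ?expR_gt0// mulr_gt0// pi_gt0. Qed.

Lemma gaussian_density_cons n (x : R) (y : 'rV[R]_n) :
  gaussian_density (cons_rV (x, y)) = phi x * gaussian_density y.
Proof.
rewrite /gaussian_density normal_pdf01E big_ord_recl cons_rV0 /=.
under eq_bigr do rewrite cons_rVS /=.
rewrite mulrACA -expRD; congr (_ * expR _); last by field.
rewrite /normal_peak expr1n mul1r -[pi *+ 2]mulr_natl -powR12_sqrt; last first.
  by rewrite mulr_ge0// pi_ge0.
rewrite -powRN -powRD; last by apply/implyP => _;
  rewrite mulf_neq0// gt_eqF// pi_gt0.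
by congr (_ `^ _); rewrite -natr1; field.
Qed.

Lemma measurable_gaussian_density n :
  measurable_fun setT (@gaussian_density R n).
Proof.
have ms : measurable_fun setT (fun x : 'rV[R]_n => -
    (\sum_(i < n) x ord0 i ^+ 2) / 2).
  apply: measurable_funM => //; apply: measurable_funN.
  apply: measurable_sum => i; apply: measurable_funX.
  exact: measurable_coord.
apply: measurable_funM => //.
exact: (measurableT_comp (@measurable_expR R) ms).
Qed.

End row_vectors.

                                   

(** * The truncated inequality in every dimension *)

Lemma ae_imply2 d (T : measurableType d) (R : realType)
    (mu : {measure set T -> \bar R}) (P Q S : T -> Prop) :
  (forall x, P x -> Q x -> S x) -> {ae mu, forall x, P x} ->
  {ae mu, forall x, Q x} -> {ae mu, forall x, S x}.
Proof.
move=> PQS p q; apply: negligibleS (filterI p q) => x /=.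
by apply: contra_not => -[]; exact: PQS.
Qed.

Section gaussian_comparison.
Context {R : realType}.
Notation mu := (@lebesgue_measure R).
Local Notation phi := (@normal_pdf R 0 1).
Local Notation K := (@normal_peak R 1).

Lemma log_concave_scale (E : lmodType R) (P : E -> \bar R) (c : R) : 0 < c ->
  log_concave P -> log_concave (fun x => c%:E * P x)%E.
Proof.
move=> c0 lcP; rewrite -(lnK (x := c))//.
by apply: (log_concave_expRM (l := cst (ln c))) => // x y t _ /=; lra.
Qed.

Lemma log_concave_section n (P : 'rV[R]_n.+1 -> \bar R) (y : 'rV[R]_n) :
  log_concave P -> log_concave (fun x : R^o => P (cons_rV (x, y))).
Proof.
move=> [P0 Plc]; split=> [x|x x' t a b t01 ax bx]; first exact: P0.
have := Plc _ _ _ _ _ t01 ax bx; rewrite cons_rV_comb -scalerDl.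
by rewrite [t + _]addrC subrK scale1r.
Qed.

Lemma log_concave_mul_normal n (P : 'rV[R]_n.+1 -> \bar R) : log_concave P ->
  log_concave (fun z : 'rV[R]_n.+1 => (phi (z ord0 ord0))%:E * P z)%E.
Proof.
move=> lcP.
have := log_concave_expRM
  (l := fun z : 'rV[R]_n.+1 => - (z ord0 ord0 ^+ 2 / 2) + ln K) _ lcP.
rewrite (_ : (fun x => _) =
  (fun z : 'rV[R]_n.+1 => (phi (z ord0 ord0))%:E * P z)%E); last first.
  apply/funext => z; rewrite normal_pdf01E expRD lnK 1?mulrC//.
  by rewrite posrE normal_peak_gt0// oner_eq0.
apply=> x y t /andP[t0 t1]; rewrite !mxE.
set a := x _ _; set b := y _ _.
have : 0 <= t * (1 - t) * (a - b) ^+ 2.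
  by rewrite mulr_ge0 ?sqr_ge0// mulr_ge0 ?ltW// subr_gt0.
nra.
Qed.

(** Sections of P at y, y' and their combination satisfy the hypothesis of [prekopa_leindler], whose
    conclusion is log-concavity of the integral. *)
Lemma log_concave_marginal n (P : 'rV[R]_n.+1 -> \bar R) : log_concave P ->
  log_concave (fun y : 'rV[R]_n => \int[mu]_x P (cons_rV (x, y)))%E.
Proof.
move=> lcP; have [P0 Plc] := lcP; split=> [y|y y' t a b t01 ay by'].
  by apply: integral_ge0.
have qc y0 := log_concave_quasiconcave (log_concave_section y0 lcP).
apply: (prekopa_leindler t01 (qc y) (qc y') (qc (t *: y + (1 - t) *: y'))) =>
  //.
move=> {ay by'} {}a {}b x x' ax bx.
by have := Plc _ _ _ _ _ t01 ax bx; rewrite cons_rV_comb.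
Qed.

(** Induction on n, using the line case in the first coordinate and the induction hypothesis in the
    others. The mass c is left free because the function fed to the induction hypothesis has mass
    [phi x * c]. *)
Lemma le_integral_min_gaussian n (f : 'rV[R]_n -> R) (P : 'rV[R]_n -> \bar R)
    (c t : R) :
  measurable_fun setT f -> (forall x, 0 <= f x) -> log_concave P ->
  {ae lebesgue_rV n, forall x, (f x)%:E = (P x * (gaussian_density x)%:E)%E} ->
  (\int[lebesgue_rV n]_x (f x)%:E = c%:E)%E -> 0 <= t ->
  (\int[lebesgue_rV n]_x (Num.min (f x) t)%:E <=
   \int[lebesgue_rV n]_x (Num.min (c * gaussian_density x) t)%:E)%E.
Proof.
elim: n f P c t => [|n IH] f P c t mf f0 lcP fP fc t0.
  move: fc; rewrite /= !integral_dirac//; first last.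
  - exact/measurable_EFinP.
  - by apply/measurable_EFinP; exact: measurable_minr.
  - apply/measurable_EFinP; apply: measurable_minr => //.
    by apply: measurable_funM => //; exact: measurable_gaussian_density.
  rewrite diracT !mul1e => -[->].
  rewrite /gaussian_density big_ord0 oppr0 !mul0r oppr0 powRr0 expR0.
  by rewrite !mulr1.
have c0 : 0 <= c by rewrite -lee_fin -fc; apply: integral_ge0 => x _;
    rewrite lee_fin.
have mg m := @measurable_gaussian_density R m.
have g0 m := @gaussian_density_gt0 R m.
have phi0 := @normal_pdf01_gt0 R.
have mphi : measurable_fun setT phi by exact: measurable_normal_pdf.
have mE (F : 'rV[R]_n.+1 -> R) : measurable_fun setT F ->
    measurable_fun setT (fun x => (F x)%:E).
  by move=> mF; exact/measurable_EFinP.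
have mfs y : measurable_fun [set: R] (fun x : R => f (cons_rV (x, y))).
  exact: (measurableT_comp mf (@measurable_cons_rV_section R n y)).
have mG (F : measurableTypeR R * 'rV[R]_n -> R) : measurable_fun setT F ->
    (forall p, 0 <= F p) ->
    measurable_fun setT (fun y => \int[mu]_x (F (x, y))%:E)%E.
  move=> mF F0; have :=
    @measurable_fun_fubini_tonelli_G _ _ (measurableTypeR R) 'rV[R]_n R mu
      (fun p => (F p)%:E).
  by apply=> [|p]; [exact/measurable_EFinP|rewrite lee_fin].
have mF (F : measurableTypeR R * 'rV[R]_n -> R) : measurable_fun setT F ->
    (forall p, 0 <= F p) ->
    measurable_fun [set: R]
      (fun x : R => \int[lebesgue_rV n]_y (F (x, y))%:E)%E.
  move=> mF F0; have :=
    @measurable_fun_fubini_tonelli_F _ _ (measurableTypeR R) 'rV[R]_n R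
      (lebesgue_rV n) (fun p => (F p)%:E).
  by apply=> [|p]; [exact/measurable_EFinP|rewrite lee_fin].
have mfc : measurable_fun setT
    (fun p : measurableTypeR R * 'rV[R]_n => f (cons_rV p)).
  exact: (measurableT_comp mf (@measurable_cons_rV R n)).
pose h y := (\int[mu]_x (f (cons_rV (x, y)))%:E)%E.
have h0 y : (0 <= h y)%E by apply: integral_ge0 => x _; rewrite lee_fin.
have mh : measurable_fun setT h by exact: mG mfc _.
have hc : (\int[lebesgue_rV n]_y h y = c%:E)%E.
  by rewrite -fc ge0_integral_rVS => [//||z]; [exact: mE|rewrite lee_fin].
have hfin : {ae lebesgue_rV n, forall y, h y \is a fin_num}.
  have /(integrable_ae measurableT) : (lebesgue_rV n).-integrable setT h.
    apply/integrableP; split => //.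
    by under eq_integral => y _ do rewrite gee0_abs//; rewrite hc ltry.
  by apply: ae_imply => y; exact.
(* The marginal is finite only almost everywhere; [hr] is its real-valued version, with value 0
   where it is infinite. *)
pose hr y := fine (h y).
have hr0 y : 0 <= hr y by exact: fine_ge0.
have mhr : measurable_fun setT hr by exact: measurableT_comp.
have hrc : (\int[lebesgue_rV n]_y (hr y)%:E = c%:E)%E.
  rewrite -hc; apply: ge0_ae_eq_integral => //.
  - exact/measurable_EFinP.
  - by move=> y _; rewrite lee_fin.
  - by apply: ae_imply hfin => y hy _; rewrite fineK.
pose P1 (z : 'rV[R]_n.+1) := ((phi (z ord0 ord0))%:E * P z)%E.
have lcP1 : log_concave P1 := log_concave_mul_normal lcP.
(* The density of the marginal relative to the Gaussian in dimension n. *)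
pose Q y := (\int[mu]_x P1 (cons_rV (x, y)))%E.
have lcQ : log_concave Q := log_concave_marginal lcP1.
have fPs := ae_rVS fP.
have hrQ : {ae lebesgue_rV n, forall y, (hr y)%:E =
    (Q y * (gaussian_density y)%:E)%E}.
  apply: (ae_imply2 _ hfin fPs) => y hy fy.
  rewrite fineK// /Q muleC -ge0_integralZl_EFin//; first last.
  - exact: ltW.
  - exact: quasiconcave_measurable
      (log_concave_quasiconcave (log_concave_section y lcP1)).
  - by move=> x _; exact: lcP1.1.
  apply: ge0_ae_eq_integral => //.
  - by apply/measurable_EFinP; exact: mfs.
  - apply: measurable_funeM.
    exact: quasiconcave_measurable
      (log_concave_quasiconcave (log_concave_section y lcP1)).
  - by move=> x _; rewrite lee_fin.
  - by move=> x _; rewrite mule_ge0 ?lcP1.1// lee_fin ltW.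
  apply: ae_imply fy => x -> _.
  by rewrite gaussian_density_cons /P1 cons_rV0 /= EFinM muleA
    [(P _ * _)%E]muleC [RHS]muleC.
rewrite !ge0_integral_rVS//; first last.
- by move=> z; rewrite lee_fin le_min f0.
- by apply: mE; exact: measurable_minr.
- by move=> z; rewrite lee_fin le_min t0 mulr_ge0// ltW.
- apply: mE; apply: measurable_minr => //; apply: measurable_funM => //;
    exact: mg.
have mm : measurable_fun setT (fun p : measurableTypeR R * 'rV[R]_n =>
    Num.min (hr p.2 * phi p.1) t).
  apply: measurable_minr => //; apply: measurable_funM.
    exact: (measurableT_comp mhr measurable_snd).
  exact: (measurableT_comp mphi measurable_fst).
have mm0 (p : measurableTypeR R * 'rV[R]_n) : 0 <= Num.min (hr p.2 * phi p.1) t.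
  by rewrite le_min t0 mulr_ge0// ltW.
have mm' : measurable_fun setT (fun p : measurableTypeR R * 'rV[R]_n =>
    Num.min (c * gaussian_density (cons_rV p)) t).
  apply: measurable_minr => //; apply: measurable_funM => //.
  exact: (measurableT_comp (mg _) (@measurable_cons_rV R n)).
have mm0' (p : measurableTypeR R * 'rV[R]_n) :
    0 <= Num.min (c * gaussian_density (cons_rV p)) t.
  by rewrite le_min t0 mulr_ge0// ltW.
(* Intermediate function: the marginal of f times the normal density. The line case gives the first
   inequality, for almost every y. *)
apply: (@le_trans _ _ (\int[lebesgue_rV n]_y \int[mu]_x
  (Num.min (hr y * phi x) t)%:E)%E).
  apply: ae_ge0_le_integral => //.
  - by move=> y _; apply: integral_ge0 => x _; rewrite lee_fin le_min f0.
  - apply: (mG (fun p => Num.min (f (cons_rV p)) t));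
      first exact: measurable_minr.
    by move=> p; rewrite le_min f0.
  - by move=> y _; apply: integral_ge0 => x _;
      rewrite lee_fin le_min mulr_ge0// ltW.
  - exact: (mG (fun p => Num.min (hr p.2 * phi p.1) t)).
  apply: (ae_imply2 _ hfin fPs) => y hy fy _.
  apply: (le_integral_min_normal
    (P := fun x => ((gaussian_density y)%:E * P (cons_rV (x, y)))%E)) => //.
  - by apply: log_concave_scale => //; exact: log_concave_section.
  - apply: ae_imply fy => x ->.
    by rewrite gaussian_density_cons EFinM muleA muleAC [(P _ * _)%E]muleC.
  - by rewrite fineK.
(* Exchange the order of integration, so that the induction hypothesis can be used at each fixed
   x. *)
rewrite -(fubini_tonelli (m1 := mu)
  (fun p => (Num.min (hr p.2 * phi p.1) t)%:E));
  [|exact/measurable_EFinP|by move=> p; rewrite lee_fin].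
rewrite -(fubini_tonelli (m1 := mu)
  (fun p => (Num.min (c * gaussian_density (cons_rV p)) t)%:E));
  [|exact/measurable_EFinP|by move=> p; rewrite lee_fin].
apply: ge0_le_integral => //.
- by move=> x _; apply: integral_ge0 => y _;
    rewrite lee_fin le_min t0 mulr_ge0// ltW.
- exact: (mF (fun p => Num.min (hr p.2 * phi p.1) t)).
- exact: (mF (fun p => Num.min (c * gaussian_density (cons_rV p)) t)).
move=> x _.
under eq_integral do rewrite [hr _ * _]mulrC.
under [leRHS]eq_integral do rewrite gaussian_density_cons mulrA.
have mphr : measurable_fun setT (fun y => phi x * hr y)
    by exact: measurable_funM.
have phr0 y : 0 <= phi x * hr y by rewrite mulr_ge0// ltW.
have lcxQ : log_concave (fun y => (phi x)%:E * Q y)%E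
    by exact: log_concave_scale.
have ae_x : {ae lebesgue_rV n, forall y,
    (phi x * hr y)%:E = ((phi x)%:E * Q y * (gaussian_density y)%:E)%E}.
  by apply: ae_imply hrQ => y hy; rewrite EFinM hy muleA.
have int_x : (\int[lebesgue_rV n]_y (phi x * hr y)%:E = (phi x * c)%:E)%E.
  under eq_integral do rewrite EFinM.
  rewrite ge0_integralZl_EFin//; first by rewrite hrc -EFinM.
  - by move=> y _; rewrite lee_fin.
  - exact/measurable_EFinP.
  - exact: ltW.
apply: le_trans (IH _ _ _ _ mphr phr0 lcxQ ae_x int_x t0) _.
by rewrite [phi x * c]mulrC.
Qed.

End gaussian_comparison.

                                            

(** * Convex functions on the half-line and their truncations *)

Section convex_real.
Context {R : realType}.
Implicit Types (phi psi A : R -> R) (r s t x y z b c d : R).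

Definition convex_slopes phi := forall x y z, 0 <= x -> x < y -> y < z ->
  (phi y - phi x) * (z - y) <= (phi z - phi y) * (y - x).

Lemma convex_function_slopes phi :
  convex_function [set r : R | (0 <= r)%R] phi -> convex_slopes phi.
Proof.
move=> cphi x y z x0 xy yz.
have zx : 0 < z - x by lra.
pose t := (z - y) / (z - x).
have t0 : 0 <= t by apply: divr_ge0; lra.
have t1 : t <= 1 by rewrite /t ler_pdivrMr// mul1r lerD2l lerN2 ltW.
have z0 : 0 <= z by lra.
have : phi (t * x + (1 - t) * z) <= t * phi x + (1 - t) * phi z.
  by apply: (cphi (Itv01 t0 t1) x z); rewrite inE.
rewrite (_ : t * x + (1 - t) * z = y); last by rewrite /t; field;
  rewrite gt_eqF.
rewrite -(ler_pM2r zx) mulrDl.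
rewrite (_ : t * phi x * (z - x) = phi x * (z - y)); last by rewrite /t; field;
  rewrite gt_eqF.
rewrite (_ : (1 - t) * phi z * (z - x) = phi z * (y - x)); last by rewrite /t;
  field; rewrite gt_eqF.
lra.
Qed.

Lemma convex_slopes_mono phi r s t u : convex_slopes phi ->
  0 <= r -> r < s -> s <= t -> t < u ->
  (phi s - phi r) * (u - t) <= (phi u - phi t) * (s - r).
Proof.
move=> cphi r0 rs; rewrite le_eqVlt => /predU1P[<-|st] tu; first exact: cphi.
have := cphi _ _ _ r0 rs st; have := cphi _ _ _ (le_trans r0 (ltW rs)) st tu.
set a := phi s - phi r; set p := phi t - phi s; set q := phi u - phi t => H1 H2.
have ts0 : 0 < t - s by lra.
rewrite -(ler_pM2r ts0).
have ut : 0 <= u - t by lra.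
have sr : 0 <= s - r by lra.
have := ler_wpM2r ut H2; have := ler_wpM2r sr H1; lra.
Qed.

(** c is the supremum of the chord slopes ending at b from the left, which exist because b > 0;
    every slope to the right of b bounds them. *)
Lemma convex_slopes_subgradient phi b : convex_slopes phi -> 0 < b ->
  exists c, forall s, 0 <= s -> phi b + c * (s - b) <= phi s.
Proof.
move=> cphi b0.
pose A := [set (phi b - phi r) / (b - r) | r in [set r | 0 <= r < b]].
have ubA s : b < s -> ubound A ((phi s - phi b) / (s - b)).
  move=> bs _ [r /andP[r0 rb] <-]; rewrite ler_pdivrMr ?subr_gt0//.
  by rewrite mulrAC ler_pdivlMr ?subr_gt0//; exact: cphi.
have A0 : A !=set0 by exists ((phi b - phi 0) / (b - 0)), 0;
    rewrite //= lexx b0.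
exists (sup A) => s s0; have [sb|bs|->] := ltgtP s b; last
  by rewrite subrr mulr0 addr0.
  have : (phi b - phi s) / (b - s) <= sup A.
    apply: ub_le_sup; last by exists s => //=; rewrite s0.
    by exists ((phi (b + 1) - phi b) / (b + 1 - b)); apply: ubA; lra.
  by rewrite ler_pdivrMr ?subr_gt0//; lra.
have : sup A <= (phi s - phi b) / (s - b) by apply: ge_sup => //; exact: ubA.
by rewrite ler_pdivlMr ?subr_gt0//; lra.
Qed.

Section truncation.
Variables (phi : R -> R) (b c : R).
Hypotheses (cphi : convex_slopes phi) (b0 : 0 < b).
Hypothesis cb : forall s, 0 <= s -> phi b + c * (s - b) <= phi s.

                                                                               
                                                                              
(** Subtract the linear part of the supporting line at b, then freeze the values outside [0, b]. As
    b minimizes [phi s - c * s] on the half-line, the result is nonincreasing; freezing below 0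
    makes this hold on all of R, which gives measurability. *)
Definition convex_truncation (s : R) : R :=
  phi (Num.min (Num.max s 0) b) - c * Num.min (Num.max s 0) b.
Local Notation psi := convex_truncation.

Lemma convex_truncationE s : 0 <= s <= b -> psi s = phi s - c * s.
Proof. by move=> /andP[s0 sb]; rewrite /psi max_l// min_l. Qed.

Lemma convex_truncation_cst s : b <= s -> psi s = psi b.
Proof.
move=> bs; rewrite [RHS]convex_truncationE ?lexx ?ltW//.
have s0 : 0 <= s := le_trans (ltW b0) bs.
by rewrite /psi max_l// min_r.
Qed.

Lemma convex_truncation_le s : 0 <= s -> psi s + c * s <= phi s.
Proof.
move=> s0; have [sb|bs] := leP s b.
  by rewrite convex_truncationE ?s0// subrK.
rewrite (convex_truncation_cst (ltW bs)) convex_truncationE ?lexx ?(ltW b0)//.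
by have := cb s0; lra.
Qed.

Lemma convex_truncation_nincr : {homo psi : r s / r <= s >-> s <= r}.
Proof.
move=> r s rs; have psiN x : x < 0 -> psi x = psi 0.
  by move=> x0; rewrite /psi maxxx max_r// ltW.
wlog r0 : r rs / 0 <= r.
  move=> H; have [|r0] := leP 0 r; first exact: H.
  rewrite (psiN _ r0); have [s0|s0] := leP 0 s; first exact: H.
  by rewrite (psiN _ s0).
have [br|rb] := leP b r.
  by rewrite !convex_truncation_cst// (le_trans br).
wlog sb : s rs / s <= b.
  move=> H; have [|bs] := leP s b; first exact: H.
  by rewrite (convex_truncation_cst (ltW bs)); apply: H => //; exact: ltW.
have s0 : 0 <= s := le_trans r0 rs; have rb' := ltW rb.
rewrite (@convex_truncationE s) ?s0// (@convex_truncationE r) ?r0//.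
move: rs; rewrite le_eqVlt => /predU1P[->//|rs].
move: sb; rewrite le_eqVlt => /predU1P[->|sb]; first by have := cb r0; lra.
have := cphi r0 rs sb; have := cb s0.
have bs0 : 0 < b - s by lra.
have sr0 : 0 < s - r by lra.
move=> H1 H2; rewrite -(ler_pM2r bs0).
by have := ler_wpM2r (ltW sr0) H1; lra.
Qed.

Lemma convex_truncation_slopes : convex_slopes psi.
Proof.
move=> x y z x0 xy yz; have yx := convex_truncation_nincr (ltW xy).
have [by_|yb] := leP b y.
  rewrite (convex_truncation_cst by_)
    (convex_truncation_cst (le_trans by_ (ltW yz))).
  rewrite subrr mul0r mulr_le0_ge0 ?subr_le0 ?subr_ge0 ?(ltW yz)//.
  by rewrite -(convex_truncation_cst by_).
wlog zb : z yz / z <= b.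
  move=> H; have [|bz] := leP z b; first exact: H.
  rewrite (convex_truncation_cst (ltW bz)).
  apply: le_trans (H b yb (lexx b)).
  by rewrite ler_wnM2l ?subr_le0// lerD2r ltW.
rewrite !convex_truncationE; try by apply/andP; split; lra.
by have := cphi x0 xy yz; lra.
Qed.

End truncation.
End convex_real.

(** * Piecewise linear approximation of a nonincreasing convex function *)

Section interpolation.
Context {R : realType}.
Implicit Types (A psi m D : R -> R) (r s b d : R) (N i : nat).

                                                                              
                                                                        
Definition chord_slope psi d i : R :=
  (psi (i.+2%:R * d) - psi (i.+1%:R * d)) / d.

(** For s >= 0, the difference of minima is the length of cell i lying below s, so this is the
    primitive vanishing at 0 of the step function of slopes; only its increments matter. *)
Definition shifted_interpolant psi d N s : R :=
  \sum_(0 <= i < N) chord_slope psi d i *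
    (Num.min s (i.+1%:R * d) - Num.min s (i%:R * d)).

(** Cellwise bounds on increments add up along the grid. It is used for psi itself and for the
    negative of its translate by 2 d, to bound the interpolant from both sides. *)
Lemma sum_cells_le A (m : nat -> R) d N r s : 0 <= d -> 0 <= r -> r <= s ->
  (forall i x y, (i < N)%N -> i%:R * d <= x -> x <= y -> y <= i.+1%:R * d ->
     A y - A x <= m i * (y - x)) ->
  A (Num.min s (N%:R * d)) - A (Num.min r (N%:R * d)) <=
  \sum_(0 <= i < N) m i * (Num.min s (i.+1%:R * d) - Num.min s (i%:R * d)) -
  \sum_(0 <= i < N) m i * (Num.min r (i.+1%:R * d) - Num.min r (i%:R * d)).
Proof.
move=> d0 r0 rs; have s0 := le_trans r0 rs.
elim: N => [|N IH] cell.
  by rewrite !big_nil mul0r !min_r// !subrr.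
rewrite !big_nat_recr//=;
  have {}IH := IH (fun i x y iN => cell i x y (ltnW iN)).
have := cell N _ _ (ltnSn N).
have : N%:R * d <= N.+1%:R * d by rewrite ler_wpM2r// ler_nat.
move: IH; set p := N%:R * d; set q := N.+1%:R * d; set u := \sum_(_ <= _ < _) _;
  set v := \sum_(_ <= _ < _) _.
move=> IH pq cellN.
have [sp|ps] := leP s p.
  have rp := le_trans rs sp; have sq := le_trans sp pq;
    have rq := le_trans rp pq.
  by move: IH; rewrite !min_l//; lra.
move: IH; rewrite (min_r (ltW ps)).
have [rp|pr] := leP r p.
  have rq := le_trans rp pq; rewrite (min_l rq).
  have := cellN p (Num.min s q) (lexx _).
  rewrite le_min (ltW ps) pq ge_min lexx orbT => /(_ isT isT); lra.
have := cellN (Num.min r q) (Num.min s q).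
rewrite !le_min !ge_min (ltW pr) rs pq lexx !orbT /= => /(_ isT isT isT); lra.
Qed.

(** Summation by parts: the terms left over are products of a nonnegative increment of m with a
    nonpositive D. *)
Lemma abel_sum_ge (m D : nat -> R) N : {homo m : i j / (i <= j)%N >-> i <= j} ->
  (forall i, D i <= 0) -> D 0%N = 0 ->
  m N * D N <= \sum_(0 <= i < N) m i * (D i.+1 - D i).
Proof.
move=> mm D0 D00; elim: N => [|N IH]; first by rewrite big_nil D00 mulr0.
rewrite big_nat_recr//=.
have := D0 N.+1; have := mm _ _ (leqnSn N) => mN DN.
have := ler_wnM2r DN mN; lra.
Qed.

Variables (psi : R -> R) (b : R).
Hypotheses (psi_nincr : {homo psi : r s / r <= s >-> s <= r})
  (psi_convex : convex_slopes psi)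
    (psi_cst : forall s, b <= s -> psi s = psi b).

Lemma chord_slope_le0 d i : 0 < d -> chord_slope psi d i <= 0.
Proof.
move=> d0; apply: mulr_le0_ge0; last by rewrite invr_ge0 ltW.
by rewrite subr_le0; apply: psi_nincr; rewrite ler_pM2r// ler_nat.
Qed.

Let grid_lt d i : 0 < d -> i%:R * d < i.+1%:R * d.
Proof. by move=> d0; rewrite ltr_pM2r// ltr_nat. Qed.

Let gridS d i : i.+1%:R * d - i%:R * d = d.
Proof. by rewrite -mulrBl -natrB// subSnn mul1r. Qed.

Let grid_ge0 d i : 0 < d -> 0 <= i%:R * d.
Proof. by move=> d0; rewrite mulr_ge0// ltW. Qed.

Lemma chord_slope_homo d : 0 < d ->
    {homo chord_slope psi d : i j / (i <= j)%N >-> i <= j}.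
Proof.
move=> d0; apply: homo_leq => //; first exact: le_trans.
move=> i; rewrite /chord_slope ler_pM2r ?invr_gt0//.
have := psi_convex (grid_ge0 i.+1 d0) (grid_lt i.+1 d0) (grid_lt i.+2 d0).
by rewrite !gridS ler_pM2r.
Qed.

Lemma shifted_interpolant_ge d N r s : 0 < d -> N%:R * d = b -> 0 <= r ->
    r <= s ->
  psi s - psi r <= shifted_interpolant psi d N s -
    shifted_interpolant psi d N r.
Proof.
move=> d0 Nd r0 rs.
have E x : psi x = psi (Num.min x (N%:R * d)).
  by rewrite Nd; case: leP => // /ltW; exact: psi_cst.
rewrite (E s) (E r); apply: sum_cells_le => //; first exact: ltW.
move=> i x y iN ix; rewrite le_eqVlt => /predU1P[->|xy] yi.
  by rewrite !subrr mulr0.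
have := convex_slopes_mono psi_convex (le_trans (grid_ge0 i d0) ix) xy yi
  (grid_lt i.+1 d0).
by rewrite gridS /chord_slope mulrAC ler_pdivlMr.
Qed.

Lemma shifted_interpolant_le d N r s : 0 < d -> N%:R * d = b -> 0 <= r ->
    r <= s ->
  shifted_interpolant psi d N s - shifted_interpolant psi d N r <=
  psi (s + 2 * d) - psi (r + 2 * d).
Proof.
move=> d0 Nd r0 rs.
have E x : psi (x + 2 * d) = psi (Num.min x (N%:R * d) + 2 * d).
  rewrite Nd; case: leP => // /ltW bx.
  by rewrite (psi_cst (s := x + _)) ?(psi_cst (s := b + _))//; lra.
rewrite (E s) (E r) -lerN2 !opprB /shifted_interpolant.
have := @sum_cells_le (fun x => - psi (x + 2 * d))
  (fun i => - chord_slope psi d i)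
  d N r s (ltW d0) r0 rs.
rewrite /= opprK addrC => H; apply: le_trans (H _) _; last first.
  under eq_bigr do rewrite mulNr.
  under [X in - X]eq_bigr do rewrite mulNr.
  by rewrite !sumrN opprK addrC.
move=> i x y iN ix; rewrite le_eqVlt => /predU1P[->|xy] yi.
  by rewrite !subrr mulr0.
have ixd : i.+2%:R * d <= x + 2 * d.
  by have := gridS d i; have := gridS d i.+1; lra.
have xyd : x + 2 * d < y + 2 * d by rewrite ltrD2r.
have := convex_slopes_mono psi_convex (grid_ge0 i.+1 d0) (grid_lt i.+1 d0) ixd
  xyd.
have cE : psi (i.+2%:R * d) - psi (i.+1%:R * d) = chord_slope psi d i * d.
  by rewrite /chord_slope divfK// gt_eqF.
rewrite gridS cE mulrAC ler_pM2r//; lra.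
Qed.

Lemma shifted_interpolant_nincr d N : 0 < d ->
  {homo shifted_interpolant psi d N : r s / r <= s >-> s <= r}.
Proof.
move=> d0 r s rs; apply: ler_sum => i _; rewrite ler_wnM2l ?chord_slope_le0//.
have := grid_lt i d0; set p := i%:R * d; set q := i.+1%:R * d => pq.
by case: (leP s q) => ?; case: (leP s p) => ?; case: (leP r q) => ?;
  case: (leP r p) => ?; lra.
Qed.

(** The slope just to the right of r is at least that of the chord from 0 to r. It is a modulus of
    right continuity at r > 0, with no continuity at 0 involved. *)
Lemma convex_slopes_right_modulus r d : 0 < r -> 0 < d ->
  psi r - psi (r + d) <= d * ((psi 0 - psi r) / r).
Proof.
move=> r0 d0; have := psi_convex (lexx 0) r0 (y := r) (z := r + d).
rewrite ltrDl d0 => /(_ isT).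
rewrite mulrA ler_pdivlMr//; lra.
Qed.

End interpolation.

                                             

(** * From truncations to convex functions *)

Section integral_comparison.
Context d (T : measurableType d) (R : realType).
Variable mu : {measure set T -> \bar R}.
Variables (f g : T -> R) (c0 : R).
Hypotheses (mf : measurable_fun setT f) (mg : measurable_fun setT g).
Hypotheses (f0 : forall x, 0 <= f x) (g0 : forall x, 0 < g x).
Hypotheses (fc : (\int[mu]_x (f x)%:E = c0%:E)%E)
  (gc : (\int[mu]_x (g x)%:E = c0%:E)%E).
Hypothesis le_min_fg : forall t, 0 <= t ->
  (\int[mu]_x (Num.min (f x) t)%:E <= \int[mu]_x (Num.min (g x) t)%:E)%E.

Local Notation pos h := (fun x => (Num.max (h x) 0)%:E).

Let integrable_of (h : T -> R) : measurable_fun setT h ->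
  (forall x, 0 <= h x) ->
  (\int[mu]_x (h x)%:E = c0%:E)%E -> mu.-integrable setT (EFin \o h).
Proof.
move=> mh h0 hc; apply/integrableP; split; first exact/measurable_EFinP.
under eq_integral => x _ do rewrite /= ger0_norm//.
by rewrite hc ltry.
Qed.

Let intf : mu.-integrable setT (EFin \o f). Proof. exact: integrable_of. Qed.
Let intg : mu.-integrable setT (EFin \o g).
Proof. by apply: integrable_of => // x; exact: ltW. Qed.

Let int_min (h : T -> R) (t : R) : measurable_fun setT h ->
  (forall x, 0 <= h x) ->
  0 <= t -> mu.-integrable setT (EFin \o h) ->
  mu.-integrable setT (EFin \o (fun x => Num.min (h x) t)).
Proof.
move=> mh h0 t0; apply: le_integrable => //.
  by apply/measurable_EFinP; exact: measurable_minr.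
by move=> x _ /=; rewrite lee_fin !ger0_norm ?le_min ?h0// ge_min lexx.
Qed.

Lemma integral_maxE (h : T -> R) : mu.-integrable setT (EFin \o h) ->
  (\int[mu]_x (h x)%:E = \int[mu]_x pos h x - \int[mu]_x pos (\- h) x)%E.
Proof.
move=> ih; rewrite integralE; congr (_ - _)%E; apply: eq_integral => x _.
  by rewrite funeposE EFin_max.
by rewrite funenegE EFin_max.
Qed.

Lemma integral_max_lty (h : T -> R) : mu.-integrable setT (EFin \o h) ->
  (\int[mu]_x pos h x < +oo)%E.
Proof.
move=> /integrable_funepos ih;
  have := integrable_lty measurableT (ih measurableT).
by under eq_integral => x _ do rewrite funeposE -EFin_max.
Qed.

Section decreasing.
Variables (psi : R -> R) (b : R).
Hypotheses (b0 : 0 < b) (psi_nincr : {homo psi : r s / r <= s >-> s <= r})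
  (psi_convex : convex_slopes psi)
    (psi_cst : forall s, b <= s -> psi s = psi b).

(** The interpolant is a combination of truncations at grid points, whose integrated differences D
    are nonpositive. Its slopes increase and are nonpositive, so [abel_sum_ge] bounds the integral
    below by a product of two nonpositive numbers. *)
Lemma integral_interpolant_ge0 (e : R) (N : nat) : 0 < e ->
  let k x := shifted_interpolant psi e N (f x) -
    shifted_interpolant psi e N (g x) in
  mu.-integrable setT (EFin \o k) /\ (0 <= \int[mu]_x (k x)%:E)%E.
Proof.
move=> e0 k.
pose u i x := Num.min (f x) (i%:R * e) - Num.min (g x) (i%:R * e).
have t0 i : 0 <= i%:R * e by rewrite mulr_ge0// ltW.
have iu i : mu.-integrable setT (EFin \o u i).
  rewrite (_ : _ \o _ = (fun x => (Num.min (f x) (i%:R * e)%R)%:E -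
    (Num.min (g x) (i%:R * e)%R)%:E)%E)//.
  apply: integrableB => //; apply: int_min => //.
  by move=> x; exact: ltW.
pose D i := fine (\int[mu]_x (u i x)%:E).
have DE i : (\int[mu]_x (u i x)%:E = (D i)%:E)%E.
  by rewrite fineK//; exact: (integrable_fin_num measurableT (iu i)).
have D0 i : D i <= 0.
  rewrite -lee_fin -DE integralB_EFin//; [|exact: int_min|].
    by rewrite sube_le0; exact: le_min_fg.
  by apply: int_min => // x; exact: ltW.
have D00 : D 0%N = 0.
  rewrite /D integral0_eq// => x _.
  by rewrite /u mul0r !min_r ?subrr// ltW.
pose w i x := ((chord_slope psi e i)%:E * ((u i.+1 x)%:E - (u i x)%:E))%E.
have iw i : mu.-integrable setT (w i).
  by apply: integrableZl => //; apply: integrableB => //; exact: iu.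
have kE : (fun x => (k x)%:E) = (fun x => \sum_(0 <= i < N) w i x)%E.
  apply/funext => x; rewrite /w.
  under eq_bigr do rewrite -EFinB -EFinM.
  rewrite sumEFin /k /shifted_interpolant -sumrB; congr EFin.
  by apply: eq_bigr => i _; rewrite /u; ring.
split.
  rewrite (_ : _ \o _ = (fun x => \sum_(0 <= i < N) w i x)%E); last exact: kE.
  by apply: integrable_sum.
rewrite kE integral_sum//.
rewrite (eq_bigr (fun i => (chord_slope psi e i * (D i.+1 - D i))%:E));
  last first.
  move=> i _; rewrite /w integralZl//; last by apply: integrableB => //;
    exact: iu.
  by rewrite integralB_EFin ?DE//; exact: iu.
rewrite sumEFin lee_fin; apply: le_trans (abel_sum_ge N _ D0 D00).
  by rewrite mulr_le0// chord_slope_le0.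
exact: chord_slope_homo.
Qed.

(** Neither part is known to be integrable here, so the claim is stated by parts. Interpolants have
    negative part at most positive part in integral; their positive parts are dominated by the one
    of the limit, and Fatou handles the negative parts. *)
Lemma integral_negpart_le :
  (\int[mu]_x (Num.max (psi (g x) - psi (f x)) 0)%:E <=
   \int[mu]_x (Num.max (psi (f x) - psi (g x)) 0)%:E)%E.
Proof.
pose k x := psi (f x) - psi (g x).
under eq_integral => x _ do rewrite -opprB -/(k x).
(* The mesh for which [j.+1] cells cover [0, b] exactly. *)
pose e j : R := b / j.+1%:R.
have e0 j : 0 < e j by rewrite divr_gt0.
have Ne j : j.+1%:R * e j = b by rewrite /e mulrC divfK// pnatr_eq0.
pose S j := shifted_interpolant psi (e j) j.+1.
pose K j x := S j (f x) - S j (g x).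
have mpsi (h : T -> R) : measurable_fun setT h ->
    measurable_fun setT (psi \o h).
  move=> mh; apply: measurableT_comp => //.
  by apply: nonincreasing_measurable => // x y; exact: psi_nincr.
rewrite -[leLHS]/(\int[mu]_x pos (\- k) x)%E -[leRHS]/(\int[mu]_x pos k x)%E.
have mk : measurable_fun setT k by apply: measurable_funB; exact: mpsi.
have mS j (h : T -> R) : measurable_fun setT h ->
    measurable_fun setT (S j \o h).
  move=> mh; apply: measurableT_comp => //.
  apply: nonincreasing_measurable => // x y.
  by apply: (shifted_interpolant_nincr psi_nincr).
have mK j : measurable_fun setT (K j) by apply: measurable_funB; exact: mS.
have mpos (h : T -> R) : measurable_fun setT h -> measurable_fun setT (pos h).
  by move=> mh; apply/measurable_EFinP; exact: measurable_maxr.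
have pos0 (h : T -> R) x : (0 <= pos h x)%E by rewrite lee_fin le_max lexx orbT.
(* Pointwise: if f <= g, the interpolant decreases by no more than psi between f and g; if g < f,
   the interpolant difference is nonpositive. *)
have posK j : (\int[mu]_x pos (K j) x <= \int[mu]_x pos k x)%E.
  apply: ge0_le_integral => //; [exact: mpos|exact: mpos|].
  move=> x _; rewrite lee_fin ge_max !le_max lexx orbT andbT.
  have [fg|gf] := leP (f x) (g x).
    apply/orP; left.
    have := shifted_interpolant_ge psi_convex psi_cst (e0 j) (Ne j) (f0 x) fg.
    by rewrite /K /k /S; lra.
  apply/orP; right.
  by rewrite subr_le0; apply: (shifted_interpolant_nincr psi_nincr) => //;
    exact: ltW.
have negK j : (\int[mu]_x pos (\- K j) x <= \int[mu]_x pos k x)%E.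
  apply: le_trans (posK j).
  have [iK] := integral_interpolant_ge0 j.+1 (e0 j).
  rewrite -/(S j) integral_maxE//.
  have fin : (\int[mu]_x pos (K j) x)%E \is a fin_num.
    by rewrite ge0_fin_numE; [exact: integral_max_lty|exact: integral_ge0].
  by rewrite sube_ge0 ?fin ?orbT.
(* Where f <= g both negative parts vanish. Where g < f, the error is at most 2 C times the mesh, C
   being the modulus constant of psi at g x > 0. *)
have cvgK x : (fun j => pos (\- K j) x) @ \oo --> pos (\- k) x.
  apply: cvg_EFin; first by apply: nearW.
  have [fg|gf] := leP (f x) (g x).
    have K0 j : Num.max ((\- K j) x) 0 = 0.
      rewrite max_r// oppr_le0 subr_ge0.
      exact: (shifted_interpolant_nincr psi_nincr).
    under eq_fun do rewrite K0.
    rewrite max_r; first exact: cvg_cst.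
    by rewrite oppr_le0 subr_ge0; exact: psi_nincr.
  pose C := (psi 0 - psi (g x)) / g x.
  have C0 : 0 <= C.
    apply: divr_ge0; last exact: ltW.
    by rewrite subr_ge0; apply: psi_nincr; exact: ltW.
  have KC j : - k x - (e j) * (2 * C) <= - K j x <= - k x.
    have ej2 : 0 < 2 * e j by have := e0 j; lra.
    have g0' := ltW (g0 x); have gf' := ltW gf.
    have := shifted_interpolant_ge psi_convex psi_cst (e0 j) (Ne j) g0' gf'.
    have := shifted_interpolant_le psi_convex psi_cst (e0 j) (Ne j) g0' gf'.
    have := convex_slopes_right_modulus psi_convex (g0 x) ej2.
    have : psi (f x + 2 * e j) <= psi (f x) by apply: psi_nincr; lra.
    rewrite -/C /K /k /S; lra.
  apply: (@squeeze_cvgr _ _ _ _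
    (fun j => Num.max (- k x) 0 - e j * (2 * C)) (fun=> Num.max (- k x) 0)).
  - apply: nearW => j; have /andP[K1 K2] := KC j.
    have eC : 0 <= e j * (2 * C) by rewrite mulr_ge0 ?(ltW (e0 j))// mulr_ge0.
    rewrite /=; apply/andP; split.
      have M1 : - K j x <= Num.max (- K j x) 0 by rewrite le_max lexx.
      have M2 : 0 <= Num.max (- K j x) 0 by rewrite le_max lexx orbT.
      by rewrite lerBlDr ge_max; apply/andP; split; lra.
    by rewrite ge_max !le_max lexx orbT K2.
  - rewrite -[X in _ --> X]subr0; apply: cvgB; first exact: cvg_cst.
    rewrite -[X in _ --> X](mul0r (2 * C)); apply: cvgM; last exact: cvg_cst.
    rewrite -(mulr0 b); apply: cvgM; [exact: cvg_cst|exact: cvg_harmonic].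
  - exact: cvg_cst.
have -> : (\int[mu]_x pos (\- k) x = \int[mu]_x limn_einf
    (fun j => pos (\- K j) x))%E.
  by apply: eq_integral => x _; rewrite (cvg_limn_einf_sup (cvgK x)).1.
apply: le_trans (fatou mu measurableT _ _) _ => //.
  by move=> j; apply: mpos; exact: measurableT_comp.
rewrite limn_einf_lim; apply: lime_le; first exact: is_cvg_einfs.
apply: nearW => j; apply: le_trans (negK j).
by apply: ereal_inf_lbound; exists j => //=.
Qed.

End decreasing.

(** Below the bound of g, phi agrees with psi plus a linear term, and everywhere on the half-line it
    lies above. So phi(f) - phi(g) is at least psi(f) - psi(g) plus a multiple of f - g, which has
    integral 0. *)
Lemma integral_convex_ge0 (phi : R -> R) (M : R) : (forall x, g x <= M) ->
  convex_slopes phi ->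
  measurable_fun setT (fun x => (phi (f x) - phi (g x))%:E) ->
  ((\int[mu]_x (fun x => (phi (f x) - phi (g x))%:E)^\+ x) +?
    - (\int[mu]_x (fun x => (phi (f x) - phi (g x))%:E)^\- x))%E ->
  (0 <= \int[mu]_x (phi (f x) - phi (g x))%:E)%E.
Proof.
move=> gM cphi mh hdef.
pose h x := phi (f x) - phi (g x).
have hpE : (\int[mu]_x (fun x => (phi (f x) - phi (g x))%:E)^\+ x =
    \int[mu]_x pos h x)%E.
  by apply: eq_integral => x _; rewrite funeposE EFin_max.
have hnE : (\int[mu]_x (fun x => (phi (f x) - phi (g x))%:E)^\- x =
    \int[mu]_x pos (\- h) x)%E.
  by apply: eq_integral => x _; rewrite funenegE EFin_max.
move: hdef; rewrite [in leRHS]integralE hpE hnE.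
have pos0 (u : T -> R) : (0 <= \int[mu]_x pos u x)%E.
  by apply: integral_ge0 => x _; rewrite lee_fin le_max lexx orbT.
(* If the positive part has infinite integral, the negative part has a finite one by
   well-definedness, and the integral is +oo. *)
have [->|] := eqVneq (\int[mu]_x pos h x)%E +oo%E.
  have := pos0 (\- h).
  by case: (\int[mu]_x pos (\- h) x)%E => [r| |]//= _ _; rewrite leey.
move=> hpoo _; rewrite -hpE -hnE -integralE.
have {hpoo} hp : (\int[mu]_x pos h x < +oo)%E by rewrite ltey.
pose b := Num.max M 1.
have b0 : 0 < b by rewrite lt_max ltr01 orbT.
have gb x : 0 <= g x <= b by rewrite ltW// /b le_max gM.
have [c cb] := convex_slopes_subgradient cphi b0.
pose psi := convex_truncation phi b c.
pose k x := psi (f x) - psi (g x).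
have kle : (\int[mu]_x pos (\- k) x <= \int[mu]_x pos k x)%E.
  under eq_integral => x _ do rewrite /= opprB.
  apply: (@integral_negpart_le psi b) => //.
  - exact: convex_truncation_nincr.
  - exact: convex_truncation_slopes.
  - by move=> s bs; exact: convex_truncation_cst.
have kh x : k x + c * (f x - g x) <= h x.
  have := convex_truncation_le b0 cb (f0 x).
  have := convex_truncationE phi c (gb x); rewrite -/psi /k /h; lra.
have mh' : measurable_fun setT h by exact/measurable_EFinP.
have mk : measurable_fun setT k.
  have mpsi (u : T -> R) : measurable_fun setT u ->
      measurable_fun setT (psi \o u).
    move=> mu'; apply: measurableT_comp => //.
    by apply: nonincreasing_measurable => // x y;
      exact: convex_truncation_nincr.
  by apply: measurable_funB; exact: mpsi.
have mpos (u : T -> R) : measurable_fun setT u -> measurable_fun setT (pos u).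
  by move=> mu'; apply/measurable_EFinP; exact: measurable_maxr.
have int_of (u : T -> R) : measurable_fun setT u ->
    (\int[mu]_x pos u x < +oo)%E -> (\int[mu]_x pos (\- u) x < +oo)%E ->
    mu.-integrable setT (EFin \o u).
  move=> mu' up un; apply/integrableP; split; first exact/measurable_EFinP.
  rewrite (eq_integral (fun x => pos u x + pos (\- u) x)%E); last first.
    move=> x _ /=; rewrite -EFinD; congr EFin.
    case: (ger0P (u x)) => u0.
      have nu0 : - u x <= 0 by rewrite oppr_le0.
      by rewrite (max_r nu0) addr0.
    have nu0 : 0 <= - u x by rewrite oppr_ge0 ltW.
    by rewrite (max_l nu0) add0r.
  rewrite ge0_integralD//; first exact: lte_add_pinfty.
  - by move=> x _; rewrite lee_fin le_max lexx orbT.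
  - exact: mpos.
  - by move=> x _; rewrite lee_fin le_max lexx orbT.
  - by apply: mpos; exact: measurableT_comp.
pose w x := `|c| * (f x + g x).
have iw : mu.-integrable setT (EFin \o w).
  rewrite (_ : _ \o _ = (fun x => `|c|%:E * ((f x)%:E + (g x)%:E))%E)//.
  by apply: integrableZl => //; exact: integrableD.
have w0 x : 0 <= w x by rewrite mulr_ge0// addr_ge0// ltW.
have cw x : `|c * (f x - g x)| <= w x.
  rewrite normrM ler_wpM2l// (le_trans (ler_normB _ _))//.
  by rewrite !ger0_norm// ltW.
(* The positive part of k is at most that of h plus w, both of finite integral; [kle] then makes k
   integrable. *)
have kp : (\int[mu]_x pos k x < +oo)%E.
  apply: (@le_lt_trans _ _ (\int[mu]_x (pos h x + (w x)%:E))%E).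
    apply: ge0_le_integral => //.
    - by move=> x _; rewrite lee_fin le_max lexx orbT.
    - exact: mpos.
    - apply: emeasurable_funD; first exact: mpos.
      exact: (measurable_int mu iw).
    move=> x _; rewrite -EFinD lee_fin ge_max; apply/andP; split.
      have := kh x; have := cw x; rewrite ler_norml => /andP[c1 c2].
      have : h x <= Num.max (h x) 0 by rewrite le_max lexx.
      lra.
    by rewrite addr_ge0// le_max lexx orbT.
  rewrite ge0_integralD//.
  - apply: lte_add_pinfty => //; exact: integrable_lty.
  - by move=> x _; rewrite lee_fin le_max lexx orbT.
  - exact: mpos.
  - by move=> x _; rewrite lee_fin.
  - exact: (measurable_int mu iw).
have ik : mu.-integrable setT (EFin \o k).
  by apply: int_of => //; exact: le_lt_trans kle kp.
pose v x := c * (f x - g x).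
have iv : mu.-integrable setT (EFin \o v).
  rewrite (_ : _ \o _ = (fun x => c%:E * ((f x)%:E - (g x)%:E))%E)//.
  by apply: integrableZl => //; exact: integrableB.
have v0 : (\int[mu]_x (v x)%:E = 0)%E.
  under eq_integral do rewrite EFinM EFinB.
  rewrite integralZl//; last exact: integrableB.
  by rewrite integralB_EFin// fc gc subee// mule0.
have ikv : mu.-integrable setT (fun x => (k x)%:E + (v x)%:E)%E
    by exact: integrableD.
have kv0 : (0 <= \int[mu]_x ((k x)%:E + (v x)%:E))%E.
  rewrite (integralD_EFin measurableT ik iv) [X in (_ + X)%E]v0 adde0
    integral_maxE//.
  have fin : (\int[mu]_x pos k x)%E \is a fin_num.
    by rewrite ge0_fin_numE.
  by rewrite sube_ge0 ?fin ?orbT.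
(* Integrability of h: its positive part is finite by assumption, and its negative part is dominated
   by that of the integrable lower bound k + v. *)
apply: (le_trans kv0); apply: le_integral => //.
  apply: int_of => //.
  apply: (@le_lt_trans _ _ (\int[mu]_x pos (\- (k \+ v)) x)%E).
    apply: ge0_le_integral => //.
    - by move=> x _; rewrite lee_fin le_max lexx orbT.
    - by apply: mpos; exact: measurableT_comp.
    - apply: mpos; apply: measurableT_comp => //; apply/measurable_EFinP.
      exact: (measurable_int mu ikv).
    move=> x _; rewrite lee_fin ge_max !le_max lexx orbT andbT; apply/orP; left.
    by rewrite lerN2; exact: kh.
  apply: integral_max_lty.
  rewrite (_ : _ \o _ = (-%E \o (fun x => (k x)%:E + (v x)%:E))%E);
    first exact: integrableN.
  by apply/funext.
by move=> x _; rewrite -EFinD lee_fin; exact: kh.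
Qed.
End integral_comparison.

                             

(** * Mass and bound of the Gaussian, and the conclusion *)

Lemma integral_gaussian_density (R : realType) n :
  (\int[@lebesgue_rV R n]_x (gaussian_density x)%:E = 1)%E.
Proof.
have mE m : measurable_fun setT (fun x : 'rV[R]_m => (gaussian_density x)%:E).
  by apply/measurable_EFinP; exact: measurable_gaussian_density.
elim: n => [|n IH].
  rewrite [LHS]integral_dirac//; last exact: mE.
  rewrite diracT mul1e /gaussian_density big_ord0 oppr0.
  by rewrite !mul0r oppr0 powRr0 expR0 mulr1.
rewrite ge0_integral_rVS//; last by move=> z;
  rewrite lee_fin gaussian_density_ge0.
rewrite -[RHS]IH; apply: eq_integral => y _.
under eq_integral do rewrite gaussian_density_cons mulrC EFinM.
rewrite ge0_integralZl_EFin ?gaussian_density_ge0//.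
- by rewrite integral_normal_pdf mule1.
- by move=> x _; rewrite lee_fin normal_pdf_ge0.
- by apply/measurable_EFinP; exact: measurable_normal_pdf.
Qed.

Lemma gaussian_density_le (R : realType) n (x : 'rV[R]_n) :
  gaussian_density x <= (2 * pi) `^ (- (n%:R / 2)).
Proof.
rewrite /gaussian_density ler_piMr ?powR_ge0// expR_le1 mulNr oppr_le0.
by rewrite divr_ge0// sumr_ge0// => i _; exact: sqr_ge0.
Qed.

(** A strict lower bound [expR a] on exp(-V) excludes V = +oo, so the convexity inequality is one
    between real numbers. *)
Lemma convex_ereal_log_concave (R : realType) n (V : 'rV[R]_n -> \bar R) :
  convex_ereal V -> log_concave (fun x => expeR (- V x)).
Proof.
move=> [VN cV]; split=> [x|x y t a b /andP[t0 t1] ax bx];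
  first exact: expeR_ge0.
have t01 : 0 <= t <= 1 by rewrite !ltW.
have fin z c : ((expR c)%:E < expeR (- V z))%E ->
    exists2 v, V z = v%:E & c < - v.
  have := VN z; case: (V z) => [v| |]//= _; last first.
    by rewrite lte_fin ltNge expR_ge0.
  by rewrite lte_fin ltr_expR => cv; exists v.
have [v vE av] := fin _ _ ax; have [w wE bw] := fin _ _ bx.
have := cV x y t t01; rewrite vE wE -!EFinM -EFinD.
have := VN (t *: x + (1 - t) *: y); case: (V _) => [r| |]//= _.
rewrite !lee_fin ler_expR => rvw.
have t'0 : 0 < 1 - t by rewrite subr_gt0.
have := ler_wpM2l (ltW t0) (ltW av); have := ler_wpM2l (ltW t'0) (ltW bw); lra.
Qed.

Theorem corollary2p5 (R : realType) (n : nat) (f : 'rV[R]_n -> R)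
    (f_density : probability_density f) (f_slc : strongly_log_concave f) :
  majorizes f (@gaussian_density R n).
Proof.
have [mf f0 f1] := f_density; have [V [cV fV]] := f_slc.
move=> phi cphi [mh hdef].
apply: (@integral_convex_ge0 _ _ _ (lebesgue_rV n) f (@gaussian_density R n) 1
  mf _ f0 _ f1 _ _ phi _ (@gaussian_density_le R n)) => //.
- exact: measurable_gaussian_density.
- exact: gaussian_density_gt0.
- exact: integral_gaussian_density.
- move=> t t0.
  have := le_integral_min_gaussian mf f0 (convex_ereal_log_concave cV) fV f1 t0.
  by under [leRHS]eq_integral do rewrite mul1r.
- exact: convex_function_slopes.
Qed.
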